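(* There is a polynomial-time $O(\log k)$-competitive randomized integral algorithm for online Caching with Reserves. That is, there are an absolute constant $C$ and a randomized online integral algorithm $\mathcal B$, whose computation at each step takes time polynomial in the size of the input, such that for every choice of $m,k,\{\mathcal P(i)\},\{k_i\}$ there is a constant $b$, independent of the number of page requests, such that for every request sequence, with $\sigma$ the resulting instance, $$\mathbb E[\mathrm{cost}_{\mathcal B}(\sigma)]\le C\ln(1+k)\cdot \mathrm{cost}_{OPT}(\sigma)+b,$$ where $\mathrm{cost}_{OPT}(\sigma)$ is the cost of the optimal offline algorithm on $\sigma$ and the expectation is over the random choices of $\mathcal B$.
   Context: Caching with Reserves. An instance $\sigma$ consists of agents $[m]=\{1,\dots,m\}$, an integer cache size $k$, pairwise disjoint finite page sets $\mathcal P(i)$, $i\in[m]$, with $\mathcal P=\bigcup_i\mathcal P(i)$, integer reserves $k_i\ge 0$ with $\sum_i k_i<k$, and a sequence of requested pages $p_1,p_2,\dots\in\mathcal P$. An integral algorithm maintains a set of $k$ pages in the cache such that for each agent $i$ the cache always contains at least $k_i$ pages of $\mathcal P(i)$ (the initial cache is one such set). When $p_t$ is requested and is not in the cache, the algorithm incurs a cache miss (cost 1) and must bring $p_t$ into the cache, evicting another page. The cost of an algorithm on $\sigma$ is its total number of cache misses (a page fetched into the cache at any other time is likewise charged cost 1). An online algorithm sees $p_t$ only at time $t$; an offline algorithm knows the whole request sequence in advance. *)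

(* Defs.v *)
From HB Require Import structures.
From mathcomp Require Import all_boot all_order all_algebra.
From mathcomp Require Import reals.

Set Implicit Arguments.
Unset Strict Implicit.
Unset Printing Implicit Defensive.

Local Open Scope nat_scope.

(* The static part of an instance.  The finite set of all pages is numbered
   0, ..., num_pages - 1, and agents 0, ..., num_agents - 1. *)
Record system := System {
  num_agents : nat;
  num_pages : nat;
  cache_size : nat;
  pages_of : 'I_num_agents -> {set 'I_num_pages};
  reserve : 'I_num_agents -> nat;
  pages_disjoint : forall i j, i != j -> [disjoint pages_of i & pages_of j];
  pages_cover : \bigcup_i pages_of i = [set: 'I_num_pages];
  reserve_lt : \sum_i reserve i < cache_size }.

Definition page (S : system) := 'I_(num_pages S).
Definition cache (S : system) := {set page S}.

Definition feasible (S : system) (C : cache S) : bool :=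
  (#|C| == cache_size S) && [forall i, reserve i <= #|C :&: pages_of i|].

(* The t-th entry of a schedule is the cache content once the t-th request has
   been served. *)
Definition valid_schedule (S : system) (rs : seq (page S))
    (Cs : seq (cache S)) : bool :=
  all2 (fun p C => feasible C && (p \in C)) rs Cs.

(* Every fetched page costs 1, be it fetched because of a cache miss or not.
   Passing from C to C' fetches the pages of C' :\: C; these include the
   requested page exactly when the request is a cache miss. *)
Definition schedule_cost (S : system) (C0 : cache S) (Cs : seq (cache S)) :
    nat :=
  sumn (pairmap (fun C C' : cache S => #|C' :\: C|) C0 Cs).

(* [size rs * num_pages S] bounds the cost of every schedule, so this is the
   minimum over all valid schedules: see opt_costP. *)
Definition opt_cost (S : system) (C0 : cache S) (rs : seq (page S)) : nat :=
  \big[minn/size rs * num_pages S]_(Cs : (size rs).-tuple (cache S)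
      | valid_schedule rs Cs) schedule_cost C0 Cs.

Section OptCost.
Variable S : system.
Implicit Types (C : cache S) (p : page S).

Lemma card_cache C : #|C| = \sum_i #|C :&: pages_of i|.
Proof.
rewrite -[in LHS](setIT C) -pages_cover big_distrr /= -!sum1_card.
rewrite partition_disjoint_bigcup /=; last first.
  move=> i j ij; rewrite -setI_eq0 setIACA setIid.
  by move: (pages_disjoint ij); rewrite -setI_eq0 => /eqP ->; rewrite setI0.
by apply: eq_bigr => i _; rewrite sum1_card.
Qed.

Lemma feasible_swap C p : feasible C -> exists2 C', feasible C' & p \in C'.
Proof.
move=> fC; have [pC|pC] := boolP (p \in C); first by exists C.
have /andP[/eqP sC /forallP rC] := fC.
have [j rj] : exists j : 'I_(num_agents S), reserve j < #|C :&: pages_of j|.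
  apply/existsP; apply: contraTT (reserve_lt S).
  rewrite negb_exists => /forallP le; rewrite -leqNgt -sC card_cache.
  by apply: leq_sum => i _; rewrite leqNgt.
have /card_gt0P[q] : 0 < #|C :&: pages_of j| by apply: leq_ltn_trans rj.
rewrite inE => /andP[qC qj].
exists (p |: C :\ q); last by rewrite setU11.
apply/andP; split.
  have := cardsD1 q C; rewrite qC => e.
  by rewrite cardsU1 !inE (negPf pC) andbF /= -e sC.
apply/forallP => i; have [->|ij] := eqVneq i j.
  move: rj; rewrite (cardsD1 q) inE qC qj /= ltnS => /leq_trans; apply.
  apply: subset_leq_card; apply/subsetP => x; rewrite !inE.
  by move=> /and3P[-> -> ->]; rewrite orbT.
apply: leq_trans (rC i) _; apply: subset_leq_card; apply/subsetP => x.
rewrite !inE => /andP[-> xi]; rewrite xi !andbT; apply/orP; right.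
apply/eqP => xq; move: (pages_disjoint ij) => /pred0P/(_ x) /=.
by rewrite xi xq qj.
Qed.

Lemma valid_schedule_exists C0 (rs : seq (page S)) : feasible C0 ->
  exists Cs, valid_schedule rs Cs.
Proof.
elim: rs C0 => [|p rs IH] C0 f0; first by exists [::].
have [C fC pC] := feasible_swap p f0; have [Cs v] := IH _ fC.
by exists (C :: Cs); rewrite /valid_schedule /= fC pC.
Qed.

Lemma schedule_cost_bound C0 Cs :
  schedule_cost C0 Cs <= size Cs * num_pages S.
Proof.
rewrite /schedule_cost; elim: Cs C0 => //= C Cs IH C0.
rewrite mulSn leq_add //.
by apply: leq_trans (max_card _) _; rewrite card_ord.
Qed.

Lemma opt_costP C0 (rs : seq (page S)) : feasible C0 ->
  (exists2 Cs, valid_schedule rs Cs & schedule_cost C0 Cs = opt_cost C0 rs) /\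
  (forall Cs, valid_schedule rs Cs -> opt_cost C0 rs <= schedule_cost C0 Cs).
Proof.
move=> f0.
have lb Cs : valid_schedule rs Cs -> opt_cost C0 rs <= schedule_cost C0 Cs.
  move=> v; have sz : size Cs == size rs.
    by move: v; rewrite /valid_schedule all2E => /andP[/eqP->].
  pose T : (size rs).-tuple (cache S) := Tuple sz.
  rewrite /opt_cost -Order.NatOrder.minEnat -Order.NatOrder.leEnat.
  exact: (@Order.TotalTheory.bigmin_le_cond _ nat _ _ T).
split=> //; have [Cs v] := valid_schedule_exists rs f0.
pose K o := o = size rs * num_pages S \/
  exists2 Cs, valid_schedule rs Cs & schedule_cost C0 Cs = o.
have : K (opt_cost C0 rs).
  rewrite /opt_cost; apply: (big_ind K) => [|x y|T vT]; first by left.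
  - by rewrite /minn; case: ifP.
  - by right; exists (val T).
rewrite /K; case=> // e; exists Cs => //; apply/eqP; rewrite eqn_leq lb // andbT e.
have sz : size Cs = size rs.
  by move: v; rewrite /valid_schedule all2E => /andP[/eqP->].
by rewrite -sz schedule_cost_bound.
Qed.

End OptCost.

(* WHILE programs over binary trees, with a cost that charges the full size of
   every tree that is computed; such programs and Turing machines simulate each
   other with polynomial overhead. *)

Inductive data := Leaf | Node of data & data.

Fixpoint data_eqb (x y : data) : bool :=
  match x, y with
  | Leaf, Leaf => true
  | Node a b, Node c d => data_eqb a c && data_eqb b d
  | _, _ => false
  end.

Fixpoint data_size (x : data) : nat :=
  if x is Node a b then (data_size a + data_size b).+1 else 1.

Inductive expr :=
  | Var of nat
  | ELeaf
  | ENode of expr & expr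
  | EFst of expr
  | ESnd of expr
  | EEq of expr & expr.

Inductive cmd :=
  | Skip
  | Assign of nat & expr
  | Seq of cmd & cmd
  | If of expr & cmd & cmd
  | While of expr & cmd.

Definition store := nat -> data.
Definition update (s : store) (x : nat) (v : data) : store :=
  fun y => if y == x then v else s y.

Definition enc_bool (b : bool) : data := if b then Node Leaf Leaf else Leaf.
Definition truth (v : data) : bool := if v is Node _ _ then true else false.

Fixpoint eval (s : store) (e : expr) : data :=
  match e with
  | Var x => s x
  | ELeaf => Leaf
  | ENode e1 e2 => Node (eval s e1) (eval s e2)
  | EFst e1 => if eval s e1 is Node a _ then a else Leaf
  | ESnd e1 => if eval s e1 is Node _ b then b else Leaf
  | EEq e1 e2 => enc_bool (data_eqb (eval s e1) (eval s e2))
  end.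

Fixpoint eval_time (s : store) (e : expr) : nat :=
  data_size (eval s e) +
  match e with
  | Var _ | ELeaf => 0
  | ENode e1 e2 | EEq e1 e2 => eval_time s e1 + eval_time s e2
  | EFst e1 | ESnd e1 => eval_time s e1
  end.

(* [exec c s t s'] : run from store s, program c halts in store s' after
   time t. *)
Inductive exec : cmd -> store -> nat -> store -> Prop :=
  | exec_skip s : exec Skip s 1 s
  | exec_assign s x e :
      exec (Assign x e) s (eval_time s e).+1 (update s x (eval s e))
  | exec_seq c1 c2 s1 s2 s3 t1 t2 :
      exec c1 s1 t1 s2 -> exec c2 s2 t2 s3 ->
      exec (Seq c1 c2) s1 (t1 + t2).+1 s3
  | exec_if e c1 c2 s t s' :
      exec (if truth (eval s e) then c1 else c2) s t s' ->
      exec (If e c1 c2) s (eval_time s e + t).+1 s'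
  | exec_while_false e c s :
      ~~ truth (eval s e) -> exec (While e c) s (eval_time s e).+1 s
  | exec_while_true e c s1 s2 s3 t1 t2 :
      truth (eval s1 e) -> exec c s1 t1 s2 -> exec (While e c) s2 t2 s3 ->
      exec (While e c) s1 (eval_time s1 e + t1 + t2).+1 s3.

(* Input and output are held in variable 0. *)
Definition input_store (x : data) : store := update (fun=> Leaf) 0 x.

Definition computes_in (c : cmd) (x y : data) (T : nat) : Prop :=
  exists t s, [/\ exec c (input_store x) t s, s 0 = y & t <= T].

(* Every polynomial in x is bounded by [poly_bound a x] for some a. *)
Definition poly_bound (a x : nat) : nat := a * x.+1 ^ a.

(* Numbers are encoded in unary.  This is polynomially equivalent to binary
   here: page names are smaller than the number of pages, all of which are
   listed, and the cache size is at most that number as soon as some cache is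
   feasible. *)
Definition enc_nat (n : nat) : data := iter n (Node Leaf) Leaf.

Fixpoint enc_seq (s : seq data) : data :=
  if s is x :: s' then Node x (enc_seq s') else Leaf.

Definition enc_pages (S : system) (ps : seq (page S)) : data :=
  enc_seq [seq enc_nat (val p) | p <- ps].

Definition enc_set (S : system) (C : {set page S}) : data :=
  enc_pages (enum C).

Definition enc_system (S : system) : data :=
  Node (enc_nat (cache_size S))
       (enc_seq [seq Node (enc_nat (reserve i)) (enc_set (pages_of i))
                | i <- enum 'I_(num_agents S)]).

Definition enc_instance (S : system) (C0 : cache S) (rs : seq (page S)) :
    data :=
  Node (enc_system S) (Node (enc_set C0) (enc_pages rs)).

Definition instance_size (S : system) (C0 : cache S) (rs : seq (page S)) :
    nat :=
  data_size (enc_instance C0 rs).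

(* A private memory together with the current cache content. *)
Definition config (S : system) : Type := (data * cache S)%type.

(* At each request the algorithm sees the system, its current configuration,
   the requested page and a string of fresh fair coin flips, of length
   polynomial in the size of the instance revealed so far.  A single algorithm
   handles all systems. *)
Record online_alg := OnlineAlg {
  coin_degree : nat;
  step : forall S : system, config S -> page S -> seq bool -> config S }.

Section Runs.
Variables (B : online_alg) (S : system) (C0 : cache S).

(* Number of coins flipped at the last of the requests rs. *)
Definition num_coins (rs : seq (page S)) : nat :=
  poly_bound (coin_degree B) (instance_size C0 rs).

Definition coin_shape (rs : seq (page S)) : seq nat :=
  [seq num_coins (take t.+1 rs) | t <- iota 0 (size rs)].

Definition init_config : config S := (Leaf, C0).

(* Successive configurations, one per request, when ws lists the coin strings
   of the successive steps. *)
Definition run (rs : seq (page S)) (ws : seq (seq bool)) : seq (config S) :=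
  scanl (fun cf pw => step B cf pw.1 pw.2) init_config (zip rs ws).

Definition run_caches (rs : seq (page S)) (ws : seq (seq bool)) :
    seq (cache S) :=
  [seq cf.2 | cf <- run rs ws].

Definition run_cost (rs : seq (page S)) (ws : seq (seq bool)) : nat :=
  schedule_cost C0 (run_caches rs ws).

(* The sample space is the set of all coin tapes of the total length needed on
   rs, with the uniform distribution; [reshape] cuts a tape into the strings
   used at the successive steps. *)
Definition expected_cost (R : realType) (rs : seq (page S)) : R :=
  ((\sum_(W : (sumn (coin_shape rs)).-tuple bool)
      (run_cost rs (reshape (coin_shape rs) W))%:R)
   / 2%:R ^+ sumn (coin_shape rs))%R.

End Runs.

(* Whatever the coins, the algorithm keeps feasible caches and serves every
   request. *)
Definition integral_alg (B : online_alg) : Prop :=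
  forall (S : system) (C0 : cache S) (rs : seq (page S))
    (ws : seq (seq bool)),
  feasible C0 -> shape ws = coin_shape B C0 rs ->
  valid_schedule rs (run_caches B C0 rs ws).

Definition enc_config (S : system) (cf : config S) : data :=
  Node cf.1 (enc_set cf.2).

Definition enc_step_input (S : system) (cf : config S) (p : page S)
    (w : seq bool) : data :=
  Node (enc_system S)
    (Node (enc_config cf)
       (Node (enc_nat (val p)) (enc_seq [seq enc_bool b | b <- w]))).

(* One fixed program performs each step, on every reachable configuration, in
   time polynomial in the size of the instance revealed so far (past requests
   rs and current request p). *)
Definition polytime (B : online_alg) : Prop :=
  exists (c : cmd) (a : nat),
  forall (S : system) (C0 : cache S) (rs : seq (page S)) (p : page S)
    (ws : seq (seq bool)) (w : seq bool),
  feasible C0 -> shape ws = coin_shape B C0 rs ->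
  size w = num_coins B C0 (rcons rs p) ->
  let cf := last (init_config C0) (run B C0 rs ws) in
  computes_in c (enc_step_input cf p w) (enc_config (step B cf p w))
    (poly_bound a (instance_size C0 (rcons rs p))).

(* Main.v *)
Require Import Defs.
From mathcomp Require Import all_boot all_order all_algebra.
From mathcomp Require Import zify.
From mathcomp Require Import reals exp.

(** Keep [N = 2 ^ e] virtual caches, [k < N <= 2 k], that evolve
    deterministically; the first coins choose one of them uniformly, and the
    real cache always contains the chosen one.  A virtual cache [V] may be
    smaller than a feasible cache: it only has to satisfy
    [load V = sum_i max (|V :&: P(i)|, k_i) <= k], which is what is needed to
    complete it by old pages.  On a request to [p], add [p] to all virtual
    caches and repeat: while moving some page from one virtual cache to another
    lowers the total badness
    [sum_V (sum_i (k_i - |V :&: P(i)|) + (load V - k))] (truncated differences),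
    do so; otherwise, while the loads exceed [N k] in total, double the number
    of virtual caches that miss [q], for every page [q <> p] of every agent of
    which some virtual cache holds more than its reserve.

    Let [O] be the cache of an optimal schedule.  Give a page missing from [m]
    virtual caches the level 0 if [m = 0] and [1 + log2 m] otherwise.  The
    potential is [10 N] times the sum over [q \notin O] of [e + 1 - level q],
    plus the total badness, plus twice the number of missing copies.  When a
    doubling happens, feasibility of [O] forces the doubled pages missing from
    [O] to be so many that they pay for it: if there are [y] of them, at most
    [3 N y] copies are evicted.  A page leaving [O] raises the potential by at
    most [10 N (e + 1)], and averaging over the [N] virtual caches gives the
    ratio [10 (e + 1) = O(ln (1 + k))].  *)

Set Implicit Arguments.
Unset Strict Implicit.
Unset Printing Implicit Defensive.

Local Open Scope nat_scope.

(** * Polynomial-time programs *)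

(** The coins choose an index and nothing else, so the expected cost is an average over the ensemble
    and the competitive analysis is a deterministic inequality between sums over all virtual caches.
    Virtual caches may fall short of their reserves because the real cache fills them up with pages
    it already holds: every real fetch is then a fetch of the chosen virtual cache, and thinning
    costs nothing. Moves come before doubling because only a balanced ensemble can be compared with
    [O]: once no move helps, each agent is at or above its reserve in all caches or at or below it
    in all, so the excess over [N k] lies in the hot pages. Doubling, instead of evicting single
    copies, takes a page through at most [e + 1] levels, which is the source of the logarithm. The
    algorithm never knows [O]; its number of rounds rests on a bound of the potential valid for
    every feasible [O]. Polynomial time is obtained for explicit programs by closing [poly] under
    the list operations in which a step is written; the danger is iteration, where every step may be
    polynomial and the result exponential. *)

Definition pbd (g : nat -> nat) := exists a, forall x, g x <= poly_bound a x.

Lemma poly_bound_mono a b x y :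
  a <= b -> x <= y -> poly_bound a x <= poly_bound b y.
Proof.
move=> ab xy; rewrite /poly_bound leq_mul //.
apply: leq_trans (leq_pexp2l _ ab) => //.
by case: a {ab} => // a; rewrite leq_exp2r.
Qed.

Lemma pbd_le g h : (forall x, g x <= h x) -> pbd h -> pbd g.
Proof. by move=> gh [a ha]; exists a => x; apply: leq_trans (gh x) (ha x). Qed.

Lemma pbd_intro g a b : (forall x, g x <= a * x.+1 ^ b) -> pbd g.
Proof.
move=> h; exists (maxn a b) => x; apply: leq_trans (h x) _.
rewrite /poly_bound leq_mul ?leq_maxl //.
by rewrite leq_pexp2l // leq_maxr.
Qed.

Lemma pbd_id : pbd id.
Proof. by apply: (@pbd_intro _ 1 1) => x; rewrite mul1n expn1. Qed.

Lemma pbd_const c : pbd (fun=> c).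
Proof. by apply: (@pbd_intro _ c 0) => x; rewrite muln1. Qed.

Lemma pbd_add g h : pbd g -> pbd h -> pbd (fun x => g x + h x).
Proof.
move=> [a ga] [b hb]; apply: (@pbd_intro _ (a + b) (maxn a b)) => x.
rewrite mulnDl leq_add //.
  by apply: leq_trans (ga x) _; rewrite leq_mul // leq_pexp2l // leq_maxl.
by apply: leq_trans (hb x) _; rewrite leq_mul // leq_pexp2l // leq_maxr.
Qed.

Lemma pbd_succ g : pbd g -> pbd (fun x => (g x).+1).
Proof.
move=> pg; apply: pbd_le (pbd_add pg (pbd_const 1)) => x.
by rewrite addn1.
Qed.

Lemma pbd_mul g h : pbd g -> pbd h -> pbd (fun x => g x * h x).
Proof.
move=> [a ga] [b hb]; apply: (@pbd_intro _ (a * b) (a + b)) => x.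
by rewrite expnD mulnACA leq_mul.
Qed.

Lemma pbd_comp g h : pbd g -> pbd h -> pbd (fun x => g (h x)).
Proof.
move=> [a ga] [b hb]; apply: (@pbd_intro _ (a * b.+1 ^ a) (b * a)) => x.
apply: leq_trans (ga _) _; rewrite /poly_bound -mulnA leq_mul // expnM -expnMn.
case: a {ga} => // a; rewrite leq_exp2r //.
apply: leq_ltn_trans (hb x) _; rewrite /poly_bound mulSn.
by have := expn_gt0 x.+1 b; lia.
Qed.

Lemma pbd_poly_bound a : pbd (poly_bound a).
Proof. by exists a. Qed.

Ltac pbd_tac := repeat lazymatch goal with
  | |- pbd (poly_bound _) => exact: pbd_poly_bound
  | |- pbd (muln ?c) => apply: (pbd_mul (pbd_const c) pbd_id)
  | |- pbd (addn ?c) => apply: (pbd_add (pbd_const c) pbd_id)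
  | |- pbd S => exact: (pbd_succ pbd_id)
  | |- pbd (fun x => S (@?f x)) => apply: pbd_succ
  | |- pbd (fun x => x) => exact: pbd_id
  | |- pbd (fun x => @?f x + @?g x) => apply: pbd_add
  | |- pbd (fun x => @?f x * @?g x) => apply: pbd_mul
  | |- pbd (fun x => poly_bound ?a (@?f x)) =>
      apply: (pbd_comp (pbd_poly_bound a))
  | |- pbd (fun x => _) => first [exact: pbd_const | eassumption]
  end.

(** * Encodings of numbers, booleans, pairs and lists as trees *)

Class encodable (A : Type) := Encodable {
  enc : A -> data;
  dec : data -> A;
  encK : cancel enc dec }.

Lemma enc_inj A (eA : encodable A) : injective enc.
Proof. exact: can_inj encK. Qed.

Fixpoint unseq (d : data) : seq data :=
  if d is Node a b then a :: unseq b else [::].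

Lemma enc_seqK : cancel enc_seq unseq.
Proof. by elim=> //= x s ->. Qed.

Lemma enc_natK : cancel enc_nat (fun d => size (unseq d)).
Proof. by elim=> //= n ->. Qed.

Lemma enc_boolK : cancel enc_bool truth.
Proof. by case. Qed.

Instance nat_encodable : encodable nat := Encodable enc_natK.
Instance bool_encodable : encodable bool := Encodable enc_boolK.

Section EncodePairsSeqs.
Context {A B : Type} {eA : encodable A} {eB : encodable B}.

Definition enc_pair (x : A * B) := Node (enc x.1) (enc x.2).

Definition dec_pair (d : data) : A * B :=
  if d is Node a b then (dec a, dec b) else (dec Leaf, dec Leaf).

Lemma enc_pairK : cancel enc_pair dec_pair.
Proof. by move=> [a b]; rewrite /= !encK. Qed.

Lemma enc_mapK : cancel (fun s : seq A => enc_seq (map enc s))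
                        (fun d => map dec (unseq d)).
Proof. by move=> s; rewrite enc_seqK -map_comp (eq_map encK) map_id. Qed.

End EncodePairsSeqs.

Instance pair_encodable A B (eA : encodable A) (eB : encodable B) :
  encodable (A * B) := Encodable enc_pairK.
Instance seq_encodable A (eA : encodable A) : encodable (seq A) :=
  Encodable enc_mapK.

Definition esize A {eA : encodable A} (x : A) := data_size (enc x).

Lemma data_size_gt0 d : 0 < data_size d.
Proof. by case: d. Qed.

Lemma esize_pair A B (eA : encodable A) (eB : encodable B) (a : A) (b : B) :
  esize (a, b) = (esize a + esize b).+1.
Proof. by []. Qed.

Lemma esize_cons A (eA : encodable A) (a : A) s :
  esize (a :: s) = (esize a + esize s).+1.
Proof. by []. Qed.

Lemma esize_nil A (eA : encodable A) : esize ([::] : seq A) = 1.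
Proof. by []. Qed.

Lemma esize_nat n : esize n = n.*2.+1.
Proof. by rewrite /esize; elim: n => //= n ->; rewrite doubleS. Qed.

Lemma esize_bool (b : bool) : esize b <= 3.
Proof. by case: b. Qed.

Lemma esize_gt0 A (eA : encodable A) (x : A) : 0 < esize x.
Proof. exact: data_size_gt0. Qed.

Lemma data_eqbP x y : reflect (x = y) (data_eqb x y).
Proof.
elim: x y => [|a IHa b IHb] [|c d] /=; try by constructor.
by apply: (iffP andP) => [[/IHa-> /IHb->]|[<- <-]] //; split; [apply/IHa|apply/IHb].
Qed.

(* [computes c f a]: variable 0 holds the input and the output, variable 1 is a
   stack that c restores, the other variables are scratch. *)
Definition computes A B {eA : encodable A} {eB : encodable B}
    (c : cmd) (f : A -> B) (a : nat) :=
  forall x s, s 0 = enc x -> exists t s',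
    [/\ exec c s t s', s' 0 = enc (f x), s' 1 = s 1
      & t <= poly_bound a (esize x + data_size (s 1))].

(** The bound on the output size does not involve the stack: in a composition the second program
    must run in time polynomial in the first input, whatever lies on the stack. *)
Definition poly A B {eA : encodable A} {eB : encodable B} (f : A -> B) :=
  exists c a, computes c f a /\ forall x, esize (f x) <= poly_bound a (esize x).

(** * Size and time bounds for expressions and commands *)

Fixpoint expr_size (e : expr) : nat :=
  match e with
  | Var _ | ELeaf => 1
  | ENode e1 e2 | EEq e1 e2 => (expr_size e1 + expr_size e2).+1
  | EFst e1 | ESnd e1 => (expr_size e1).+1
  end.

Fixpoint reads_le (s : store) (M : nat) (e : expr) : bool :=
  match e with
  | Var x => data_size (s x) <= M
  | ELeaf => true
  | ENode e1 e2 | EEq e1 e2 => reads_le s M e1 && reads_le s M e2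
  | EFst e1 | ESnd e1 => reads_le s M e1
  end.

Lemma eval_size s M e : reads_le s M e ->
  data_size (eval s e) <= expr_size e * M.+1.
Proof.
elim: e => [x||e1 IH1 e2 IH2|e IH|e IH|e1 IH1 e2 IH2] /=; rewrite ?mul1n.
- exact: leqW.
- by [].
- by move=> /andP[/IH1 h1 /IH2 h2]; rewrite mulSn mulnDl; lia.
- by move=> /IH; rewrite mulSn; case: (eval s e) => [|a b] /= h; lia.
- by move=> /IH; rewrite mulSn; case: (eval s e) => [|a b] /= h; lia.
- move=> /andP[/IH1 h1 /IH2 h2]; rewrite mulSn mulnDl.
  have := data_size_gt0 (eval s e1); have := data_size_gt0 (eval s e2).
  by case: data_eqb => /=; lia.
Qed.

(** Each of the at most [expr_size e] subexpressions is charged the size of its value, which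
    [eval_size] bounds; hence the square. *)
Lemma eval_time_le s M e : reads_le s M e ->
  eval_time s e <= expr_size e * expr_size e * M.+1.
Proof.
have unary n x t : x <= n.+1 * M.+1 -> t <= n * n * M.+1 ->
    x + t <= n.+1 * n.+1 * M.+1 by move=> hx ht; nia.
have binary m n x t u : x <= (m + n).+1 * M.+1 -> t <= m * m * M.+1 ->
    u <= n * n * M.+1 -> x + (t + u) <= (m + n).+1 * (m + n).+1 * M.+1.
  by move=> hx ht hu; nia.
elim: e => [x||e1 IH1 e2 IH2|e IH|e IH|e1 IH1 e2 IH2] h;
  move: (eval_size h); rewrite [eval_time _ _]/= [expr_size _]/=.
- by rewrite addn0 !mul1n.
- by rewrite addn0 !mul1n.
- by case/andP: h => /IH1 h1 /IH2 h2 hx; apply: binary.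
- by move=> hx; apply: unary (IH h).
- by move=> hx; apply: unary (IH h).
- by case/andP: h => /IH1 h1 /IH2 h2 hx; apply: binary.
Qed.

Definition exec_le c s T s' := exists2 t, exec c s t s' & t <= T.

Lemma exec_le_assign s x e M : reads_le s M e ->
  exec_le (Assign x e) s (expr_size e * expr_size e * M.+1).+1
    (update s x (eval s e)).
Proof.
move=> h; exists (eval_time s e).+1; first exact: exec_assign.
by rewrite ltnS eval_time_le.
Qed.

Lemma exec_le_seq c1 c2 s1 s2 s3 T1 T2 :
  exec_le c1 s1 T1 s2 -> exec_le c2 s2 T2 s3 ->
  exec_le (Seq c1 c2) s1 (T1 + T2).+1 s3.
Proof.
move=> [t1 e1 l1] [t2 e2 l2]; exists (t1 + t2).+1; first exact: exec_seq e1 e2.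
by rewrite ltnS leq_add.
Qed.

Lemma exec_leW c s T T' s' : T <= T' -> exec_le c s T s' -> exec_le c s T' s'.
Proof. by move=> TT [t e l]; exists t => //; apply: leq_trans TT. Qed.

Lemma computes_exec A B (eA : encodable A) (eB : encodable B) c (f : A -> B) a
    x s M :
  computes c f a -> s 0 = enc x -> esize x + data_size (s 1) <= M ->
  exists s', [/\ exec_le c s (poly_bound a M) s', s' 0 = enc (f x) & s' 1 = s 1].
Proof.
move=> h sx le; have [t [s' [e o1 o2 tl]]] := h x s sx.
exists s'; split=> //; exists t => //.
by apply: leq_trans tl _; apply: poly_bound_mono.
Qed.

(** With arbitrary polynomially bounded [g] and [h], the closure lemmas can state their bounds as
    they arise and leave the arithmetic to [pbd_tac]. *)
Lemma poly_intro A B (eA : encodable A) (eB : encodable B) (f : A -> B) c g h :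
  pbd g -> pbd h ->
  (forall x s, s 0 = enc x -> exists s', [/\
     exec_le c s (g (esize x + data_size (s 1))) s', s' 0 = enc (f x)
     & s' 1 = s 1]) ->
  (forall x, esize (f x) <= h (esize x)) -> poly f.
Proof.
move=> [a ga] [b hb] run sz; exists c, (maxn a b); split=> [x s sx|x].
  have [s' [[t e tl] o1 o2]] := run x s sx; exists t, s'; split=> //.
  apply: leq_trans tl _; apply: leq_trans (ga _) _.
  by apply: poly_bound_mono; rewrite ?leq_maxl.
apply: leq_trans (sz x) _; apply: leq_trans (hb _) _.
by apply: poly_bound_mono; rewrite ?leq_maxr.
Qed.

Fixpoint only0 (e : expr) : bool :=
  match e with
  | Var x => x == 0
  | ELeaf => true
  | ENode e1 e2 | EEq e1 e2 => only0 e1 && only0 e2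
  | EFst e1 | ESnd e1 => only0 e1
  end.

Lemma only0_reads s e : only0 e -> reads_le s (data_size (s 0)) e.
Proof.
elim: e => //= [x /eqP-> //|e1 IH1 e2 IH2|e1 IH1 e2 IH2];
by move=> /andP[/IH1-> /IH2->].
Qed.

Lemma poly_expr A B (eA : encodable A) (eB : encodable B) (f : A -> B) e :
  only0 e -> (forall s x, s 0 = enc x -> eval s e = enc (f x)) -> poly f.
Proof.
move=> o ev; set n := expr_size e.
apply: (@poly_intro _ _ _ _ _ (Assign 0 e) (fun M => n * n * (M + 1) + 1)
  (fun M => n * (M + 1))); try by pbd_tac.
- move=> x s sx; exists (update s 0 (eval s e)); split.
  + apply: exec_leW (exec_le_assign 0 (only0_reads s o)).
    by rewrite sx -/n -/(esize x); nia.
  + by rewrite /update eqxx (ev _ x).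
  + by [].
move=> x; pose s : store := fun=> @enc _ eA x.
by rewrite /esize -(ev s x) // addn1; apply: eval_size; exact: only0_reads.
Qed.

(** * Closure under composition, pairing and branching *)

Section Closure.
Context {G A B : Type} {eG : encodable G} {eA : encodable A} {eB : encodable B}.

Lemma poly_ext (f g : A -> B) : f =1 g -> poly f -> poly g.
Proof.
move=> fg [c [a [h sz]]]; exists c, a; split=> [x s sx|x]; last by rewrite -fg.
by rewrite -fg; apply: h.
Qed.

Lemma poly_id : poly (fun x : A => x).
Proof. exact: (@poly_expr _ _ _ _ _ (Var 0)). Qed.

Lemma poly_comp (f : A -> B) (g : G -> A) : poly f -> poly g ->
  poly (fun x => f (g x)).
Proof.
move=> [cf [a [hf sf]]] [cg [b [hg sg]]].
apply: (@poly_intro _ _ _ _ _ (Seq cg cf)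
  (fun M => poly_bound b M + poly_bound a (poly_bound b M + M) + 1)
  (fun M => poly_bound a (poly_bound b M))); try by pbd_tac.
- move=> x s sx; set M := esize x + data_size (s 1).
  have [s1 [e1 o1 o1']] := computes_exec hg sx (leqnn M).
  have le1 : esize (g x) + data_size (s1 1) <= poly_bound b M + M.
    rewrite o1' leq_add ?leq_addl //.
    by apply: leq_trans (sg x) _; apply: poly_bound_mono; rewrite ?leq_addr.
  have [s2 [e2 o2 o2']] := computes_exec hf o1 le1.
  exists s2; split=> //; last by rewrite o2'.
  by rewrite addn1; exact: exec_le_seq e1 e2.
- move=> x; apply: leq_trans (sf _) _.
  exact: poly_bound_mono.
Qed.

Lemma poly_const (b : B) : poly (fun _ : A => b).
Proof.
have [e oe ve] : exists2 e, only0 e & forall s, eval s e = enc b.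
  elim: (enc b) => [|x [e1 o1 v1] y [e2 o2 v2]]; first by exists ELeaf.
  by exists (ENode e1 e2) => [|s] /=; rewrite ?o1 ?v1 ?v2.
exact: (poly_expr oe).
Qed.

End Closure.

Section PairAndIf.
Context {G A B : Type} {eG : encodable G} {eA : encodable A} {eB : encodable B}.

Lemma poly_fst (f : G -> A * B) : poly f -> poly (fun x => (f x).1).
Proof.
apply: poly_comp; apply: (@poly_expr _ _ _ _ _ (EFst (Var 0))) => // s x /= ->.
by [].
Qed.

Lemma poly_snd (f : G -> A * B) : poly f -> poly (fun x => (f x).2).
Proof.
apply: poly_comp; apply: (@poly_expr _ _ _ _ _ (ESnd (Var 0))) => // s x /= ->.
by [].
Qed.

(** The input is pushed on the stack and [cf] is run; then [f x] replaces [x] on the stack while [x]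
    returns to variable 0 by way of variable 2. After [cg] the pair is assembled and the stack
    popped. Variable 2 is never relied upon across [cf] or [cg], which may overwrite it. *)
Lemma poly_pair (f : G -> A) (g : G -> B) : poly f -> poly g ->
  poly (fun x => (f x, g x)).
Proof.
move=> [cf [a [hf sf]]] [cg [b [hg sg]]].
pose c1 := Assign 1 (ENode (Var 0) (Var 1)).
pose c2 := Assign 2 (EFst (Var 1)).
pose c3 := Assign 1 (ENode (Var 0) (ESnd (Var 1))).
pose c4 := Assign 0 (Var 2).
pose c5 := Assign 0 (ENode (EFst (Var 1)) (Var 0)).
pose c6 := Assign 1 (ESnd (Var 1)).
pose prog := Seq c1 (Seq cf (Seq c2 (Seq c3 (Seq c4 (Seq cg (Seq c5 c6)))))).
(* [Z M] bounds every value read by the assignments, and [K M] the time of an assignment whose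
   expression has size at most 4. *)
pose Z M := 3 * M + 3 + poly_bound a M + poly_bound b M.
pose K M := 16 * (Z M + 1) + 1.
apply: (@poly_intro _ _ _ _ _ prog
  (fun M => 6 * K M + poly_bound a (Z M) + poly_bound b (Z M) + 10)
  (fun M => poly_bound a M + poly_bound b M + 1)); rewrite /K /Z; try by pbd_tac.
2: by move=> x; rewrite -[esize _]/((esize (f x) + esize (g x)).+1) addn1 ltnS leq_add.
move=> x s sx; set M := esize x + data_size (s 1).
rewrite -/(Z M) -/(K M).
have sfx : esize (f x) <= poly_bound a M.
  by apply: leq_trans (sf x) _; apply: poly_bound_mono; rewrite // leq_addr.
have sgx : esize (g x) <= poly_bound b M.
  by apply: leq_trans (sg x) _; apply: poly_bound_mono; rewrite // leq_addr.
have assign s0 y e : reads_le s0 (Z M) e -> expr_size e <= 4 ->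
    exec_le (Assign y e) s0 (K M) (update s0 y (eval s0 e)).
  move=> r le4; apply: exec_leW (exec_le_assign y r); rewrite /K.
  by have : expr_size e * expr_size e <= 4 * 4 by [rewrite leq_mul]; nia.
have s0sz : data_size (s 0) = esize x by rewrite sx.
have r1 : reads_le s (Z M) (ENode (Var 0) (Var 1)).
  by rewrite /= sx -/(esize x) /Z; lia.
have e1 := assign s 1 _ r1 isT.
set s1 := update _ _ _ in e1.
have s11 : s1 1 = Node (enc x) (s 1) by rewrite /s1 /update /= sx.
have [s2 [e2 o2 p2]] : exists s', [/\ exec_le cf s1 (poly_bound a (Z M)) s',
    s' 0 = enc (f x) & s' 1 = s1 1].
  apply: (computes_exec hf) => //; rewrite s11 /= -/(esize x) /Z; lia.
rewrite s11 in p2.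
have r3 : reads_le s2 (Z M) (EFst (Var 1)).
  by rewrite /= p2 /= -/(esize x) /Z; lia.
have e3 := assign s2 2 _ r3 isT; rewrite /= p2 in e3.
set s3 := update _ _ _ in e3.
have r4 : reads_le s3 (Z M) (ENode (Var 0) (ESnd (Var 1))).
  rewrite /= /s3 /update /= p2 o2 /= -/(esize x) -/(esize (f x)) /Z; lia.
have e4 := assign s3 1 _ r4 isT.
set s4 := update _ _ _ in e4.
have s41 : s4 1 = Node (enc (f x)) (s 1) by rewrite /s4 /s3 /update /= p2 o2.
have r5 : reads_le s4 (Z M) (Var 2).
  by rewrite /= /s4 /s3 /update /= -/(esize x) /Z; lia.
have e5 := assign s4 0 _ r5 isT.
set s5 := update _ _ _ in e5.
have s51 : s5 1 = Node (enc (f x)) (s 1) by rewrite -s41.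
have [s6 [e6 o6 p6]] : exists s', [/\ exec_le cg s5 (poly_bound b (Z M)) s',
    s' 0 = enc (g x) & s' 1 = s5 1].
  apply: (computes_exec hg) => //; rewrite s51 /= -/(esize (f x)) /Z; lia.
rewrite s51 in p6.
have r7 : reads_le s6 (Z M) (ENode (EFst (Var 1)) (Var 0)).
  rewrite /= p6 o6 /= -/(esize (f x)) -/(esize (g x)) /Z; lia.
have e7 := assign s6 0 _ r7 isT.
set s7 := update _ _ _ in e7.
have s71 : s7 1 = Node (enc (f x)) (s 1) by rewrite -p6.
have r8 : reads_le s7 (Z M) (ESnd (Var 1)).
  rewrite /= s71 /= -/(esize (f x)) /Z; lia.
have e8 := assign s7 1 _ r8 isT.
eexists; split.
- apply: exec_leW; last first.
  apply: (exec_le_seq e1); apply: (exec_le_seq e2); apply: (exec_le_seq e3).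
  apply: (exec_le_seq e4); apply: (exec_le_seq e5); apply: (exec_le_seq e6).
  exact: (exec_le_seq e7 e8).
  by lia.
- by rewrite /s7 /update /= p6 o6.
- by rewrite /update /= s71.
Qed.

(** The truth value survives in variable 2 because only assignments lie between [cc] and the
    branching. The saved input is popped before the branching, so both branches run on the original
    stack. *)
Lemma poly_if (c : G -> bool) (f g : G -> A) : poly c -> poly f -> poly g ->
  poly (fun x => if c x then f x else g x).
Proof.
move=> [cc [d [hc sc]]] [cf [a [hf sf]]] [cg [b [hg sg]]].
pose c1 := Assign 1 (ENode (Var 0) (Var 1)).
pose c2 := Assign 2 (Var 0).
pose c3 := Assign 0 (EFst (Var 1)).
pose c4 := Assign 1 (ESnd (Var 1)).
pose prog := Seq c1 (Seq cc (Seq c2 (Seq c3 (Seq c4 (If (Var 2) cf cg))))).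
pose Z M := 3 * M + 3.
pose K M := 16 * (Z M + 1) + 1.
apply: (@poly_intro _ _ _ _ _ prog
  (fun M => 5 * K M + poly_bound d (Z M) + poly_bound a (Z M)
            + poly_bound b (Z M) + 10)
  (fun M => poly_bound a M + poly_bound b M)); rewrite /K /Z; try by pbd_tac.
2: by move=> x; case: (c x); [rewrite (leq_trans (sf x)) ?leq_addr
                             |rewrite (leq_trans (sg x)) ?leq_addl].
move=> x s sx; set M := esize x + data_size (s 1).
rewrite -/(Z M) -/(K M).
have assign s0 y e : reads_le s0 (Z M) e -> expr_size e <= 4 ->
    exec_le (Assign y e) s0 (K M) (update s0 y (eval s0 e)).
  move=> r le4; apply: exec_leW (exec_le_assign y r); rewrite /K.
  by have : expr_size e * expr_size e <= 4 * 4 by [rewrite leq_mul]; nia.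
have r1 : reads_le s (Z M) (ENode (Var 0) (Var 1)).
  by rewrite /= sx -/(esize x) /Z; lia.
have e1 := assign s 1 _ r1 isT.
set s1 := update _ _ _ in e1.
have s11 : s1 1 = Node (enc x) (s 1) by rewrite /s1 /update /= sx.
have [s2 [e2 o2 p2]] : exists s', [/\ exec_le cc s1 (poly_bound d (Z M)) s',
    s' 0 = enc (c x) & s' 1 = s1 1].
  apply: (computes_exec hc) => //; rewrite s11 /= -/(esize x) /Z; lia.
rewrite s11 in p2.
have r3 : reads_le s2 (Z M) (Var 0).
  rewrite /= o2 -/(esize (c x)) /Z; have := esize_bool (c x); lia.
have e3 := assign s2 2 _ r3 isT; rewrite /= o2 in e3.
set s3 := update _ _ _ in e3.
have r4 : reads_le s3 (Z M) (EFst (Var 1)).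
  rewrite /= /s3 /update /= p2 /= -/(esize x) /Z; lia.
have e4 := assign s3 0 _ r4 isT.
set s4 := update _ _ _ in e4.
have s41 : s4 1 = Node (enc x) (s 1) by rewrite -p2.
have r5 : reads_le s4 (Z M) (ESnd (Var 1)).
  by rewrite /= s41 /= -/(esize x) /Z; lia.
have e5 := assign s4 1 _ r5 isT.
set s5 := update _ _ _ in e5.
have s51 : s5 1 = s 1 by rewrite /s5 /update /= s41.
have s50 : s5 0 = enc x by rewrite /s5 /s4 /s3 /update /= p2.
have [s6 [[t6 e6 l6] o6 p6]] : exists s', [/\
    exec_le (if c x then cf else cg) s5 (poly_bound a (Z M) + poly_bound b (Z M)) s',
    s' 0 = enc (if c x then f x else g x) & s' 1 = s5 1].
  have le5 : esize x + data_size (s5 1) <= Z M by rewrite s51 /Z; lia.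
  case: (c x).
    have [s6 [e6 o6 p6]] := computes_exec hf s50 le5.
    by exists s6; split=> //; apply: exec_leW e6; rewrite leq_addr.
  have [s6 [e6 o6 p6]] := computes_exec hg s50 le5.
  by exists s6; split=> //; apply: exec_leW e6; rewrite leq_addl.
have tr : truth (eval s5 (Var 2)) = c x.
  by rewrite -[eval _ _]/(enc (c x)); case: (c x).
have e6' : exec_le (If (Var 2) cf cg) s5
    (4 + poly_bound a (Z M) + poly_bound b (Z M)) s6.
  exists (eval_time s5 (Var 2) + t6).+1; first by apply: exec_if; rewrite tr.
  by rewrite -[eval_time _ _]/(esize (c x) + 0); have := esize_bool (c x); lia.
exists s6; split=> //; last by rewrite p6.
apply: exec_leW; last first.
  apply: (exec_le_seq e1); apply: (exec_le_seq e2); apply: (exec_le_seq e3).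
  apply: (exec_le_seq e4); exact: (exec_le_seq e5 e6').
by lia.
Qed.

End PairAndIf.

Section Composition2.
Context {G A B C : Type} {eG : encodable G} {eA : encodable A}
  {eB : encodable B} {eC : encodable C}.

Lemma poly_comp2 (h : A * B -> C) (f : G -> A) (g : G -> B) :
  poly h -> poly f -> poly g -> poly (fun x => h (f x, g x)).
Proof.
by move=> ph pf pg; apply: (poly_comp (g := fun x => (f x, g x))) (poly_pair pf pg).
Qed.

End Composition2.

Section BasicFunctions.
Context {G A : Type} {eG : encodable G} {eA : encodable A}.

Lemma poly_cons (f : G -> A) (g : G -> seq A) : poly f -> poly g ->
  poly (fun x => f x :: g x).
Proof.
apply: (poly_comp2 (h := fun y => y.1 :: y.2)).
(* The pair [(a, s)] and the list [a :: s] have the same encoding, so the program only copies its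
   input. *)
by apply: (@poly_expr _ _ _ _ _ (Var 0)).
Qed.

Lemma poly_behead (f : G -> seq A) : poly f -> poly (fun x => behead (f x)).
Proof.
apply: poly_comp; apply: (@poly_expr _ _ _ _ _ (ESnd (Var 0))) => // s x /= ->.
by case: x.
Qed.

Lemma poly_pred (f : G -> nat) : poly f -> poly (fun x => (f x).-1).
Proof.
apply: poly_comp; apply: (@poly_expr _ _ _ _ _ (ESnd (Var 0))) => // s x /= ->.
by case: x.
Qed.

Lemma poly_succ (f : G -> nat) : poly f -> poly (fun x => (f x).+1).
Proof.
apply: poly_comp.
by apply: (@poly_expr _ _ _ _ _ (ENode ELeaf (Var 0))) => // s x /= ->.
Qed.

Lemma poly_nilp (f : G -> seq A) : poly f -> poly (fun x => nilp (f x)).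
Proof.
apply: poly_comp; apply: (@poly_expr _ _ _ _ _ (EEq (Var 0) ELeaf)) => // s x /= ->.
by case: x.
Qed.

Lemma poly_neg (f : G -> bool) : poly f -> poly (fun x => ~~ f x).
Proof.
move=> pf; apply: (poly_ext (f := fun x => if f x then false else true)).
  by move=> x; case: (f x).
by apply: poly_if => //; apply: poly_const.
Qed.

Lemma poly_and (f g : G -> bool) : poly f -> poly g ->
  poly (fun x => f x && g x).
Proof. by move=> pf pg; apply: poly_if => //; apply: poly_const. Qed.

Lemma poly_eqn (f g : G -> nat) : poly f -> poly g -> poly (fun x => f x == g x).
Proof.
apply: (poly_comp2 (h := fun y => y.1 == y.2)).
apply: (@poly_expr _ _ _ _ _ (EEq (EFst (Var 0)) (ESnd (Var 0)))) => // s x.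
move=> /= -> /=; congr enc_bool; apply/data_eqbP/eqP => [|-> //].
exact: (@enc_inj nat).
Qed.

Lemma poly_head (f : G -> A) (l : G -> seq A) : poly f -> poly l ->
  poly (fun x => head (f x) (l x)).
Proof.
apply: (poly_comp2 (h := fun y => head y.1 y.2)).
(* A nonempty list is encoded by a [Node] and the empty one by [Leaf], so the list itself serves as
   the test. *)
pose prog := If (ESnd (Var 0)) (Assign 0 (EFst (ESnd (Var 0))))
                (Assign 0 (EFst (Var 0))).
apply: (@poly_intro _ _ _ _ _ prog (fun M => 30 * (M + 1)) id); try by pbd_tac.
  move=> y s sy; set M := esize y + _.
  have sM : data_size (s 0) <= M by rewrite sy /M leq_addr.
  have r1 : reads_le s M (ESnd (Var 0)) by [].
  have r2 : reads_le s M (EFst (ESnd (Var 0))) by [].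
  have r3 : reads_le s M (EFst (Var 0)) by [].
  have e1 := eval_time_le r1.
  have [t2 e2 l2] := exec_le_assign 0 r2.
  have [t3 e3 l3] := exec_le_assign 0 r3.
  case: y sy @M sM r1 r2 r3 e1 e2 l2 e3 l3 => [d [|a u]] sy M sM _ _ _ e1 e2 l2 e3 l3.
    exists (update s 0 (eval s (EFst (Var 0)))); split=> //; last first.
      by rewrite /update /= sy.
    exists (eval_time s (ESnd (Var 0)) + t3).+1.
      by apply: exec_if; rewrite {1}/eval sy.
    by move: e1 l3; rewrite /expr_size; lia.
  exists (update s 0 (eval s (EFst (ESnd (Var 0))))); split=> //; last first.
    by rewrite /update /= sy.
  exists (eval_time s (ESnd (Var 0)) + t2).+1.
    by apply: exec_if; rewrite {1}/eval sy.
  by move: e1 l2; rewrite /expr_size; lia.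
by move=> [d [|a u]]; rewrite /id [head _ _]/= !(esize_pair, esize_cons); lia.
Qed.

End BasicFunctions.

(** * Iteration over a list *)

Section Foldl.
Context {G A B : Type} {eG : encodable G} {eA : encodable A} {eB : encodable B}.

(** A polynomial step can still blow the accumulator up exponentially, so a polynomial bound is
    required of the accumulator after every prefix of the list. The whole state, [x] with the
    accumulator and the unread part, is kept on the stack, the only variable that [cs] is known to
    restore. *)
Lemma poly_foldl (step : G -> B -> A -> B) (init : G -> B) (l : G -> seq A) bd :
  poly (fun y : G * B * A => step y.1.1 y.1.2 y.2) -> poly init -> poly l ->
  pbd bd ->
  (forall x l1 l2, l x = l1 ++ l2 ->
     esize (foldl (step x) (init x) l1) <= bd (esize x)) ->
  poly (fun x => foldl (step x) (init x) (l x)).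
Proof.
move=> [cs [a [hs _]]] p_init p_l [b bdb] bound.
have [cp [d [hp sp]]] := poly_pair poly_id (poly_pair p_init p_l).
pose c1 := Assign 1 (ENode (Var 0) (Var 1)).
pose g := ESnd (ESnd (EFst (Var 1))).
pose b1 := Assign 0 (ENode (ENode (EFst (EFst (Var 1))) (EFst (ESnd (EFst (Var 1)))))
   (EFst (ESnd (ESnd (EFst (Var 1)))))).
pose b2 := Assign 1 (ENode (ENode (EFst (EFst (Var 1)))
   (ENode (Var 0) (ESnd (ESnd (ESnd (EFst (Var 1))))))) (ESnd (Var 1))).
pose loop := While g (Seq b1 (Seq cs b2)).
pose c3 := Assign 0 (EFst (ESnd (EFst (Var 1)))).
pose c4 := Assign 1 (ESnd (Var 1)).
pose prog := Seq cp (Seq c1 (Seq loop (Seq c3 c4))).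
(* [Z M] bounds the stack during the loop, [K M] an assignment whose expression has size at most 20,
   and [I M] one pass of the loop including its test. *)
pose Z M := 2 * M + poly_bound b M + poly_bound d M + 3.
pose K M := 400 * (Z M + 1) + 1.
pose I M := 3 * K M + poly_bound a (2 * Z M) + 5.
apply: (@poly_intro _ _ _ _ _ prog
  (fun M => poly_bound d M + 3 * K M + (poly_bound d M + 1) * I M + 10)
  (poly_bound b)); rewrite /I /K /Z; try by pbd_tac.
2: by move=> x; apply: leq_trans (bdb _); apply: (bound _ _ [::]); rewrite cats0.
move=> x s sx; set M := esize x + data_size (s 1).
rewrite -/(Z M) -/(K M) -/(I M).
have assign s0 y e : reads_le s0 (Z M) e -> expr_size e <= 20 ->
    exec_le (Assign y e) s0 (K M) (update s0 y (eval s0 e)).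
  move=> r le4; apply: exec_leW (exec_le_assign y r); rewrite /K.
  by have : expr_size e * expr_size e <= 20 * 20 by [rewrite leq_mul]; nia.
have spx : esize (x, (init x, l x)) <= poly_bound d M.
  by apply: leq_trans (sp x) _; apply: poly_bound_mono; rewrite // leq_addr.
rewrite !esize_pair in spx.
have seqE (u : seq A) : data_size (enc_seq (map enc u)) = esize u by [].
have acc l1 l2 : l x = l1 ++ l2 ->
    esize (foldl (step x) (init x) l1) <= poly_bound b M.
  move=> /bound h; apply: leq_trans h _; apply: leq_trans (bdb _) _.
  by apply: poly_bound_mono; rewrite // leq_addr.
have sizel (l1 l2 : seq A) : esize l2 <= esize (l1 ++ l2).
  by elim: l1 => //= y l1 IH; rewrite esize_cons; lia.
have stackZ l1 l2 : l x = l1 ++ l2 ->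
  data_size (Node (enc (x, (foldl (step x) (init x) l1, l2))) (s 1)) <= Z M.
  move=> e; have := acc _ _ e; have := sizel l1 l2; rewrite -e.
  rewrite [data_size _]/= -/(esize x) -/(esize (foldl _ _ _)).
  by rewrite seqE /Z; lia.
have run_loop l2 : forall l1 s0, l x = l1 ++ l2 ->
    s0 1 = Node (enc (x, (foldl (step x) (init x) l1, l2))) (s 1) ->
    exists2 s', exec_le loop s0 ((size l2).+1 * I M) s' &
      s' 1 = Node (enc (x, (foldl (step x) (init x) (l x), [::] : seq A))) (s 1).
  elim: l2 => [|y l2 IH] l1 s0 el s01.
    exists s0; last by rewrite s01 el cats0.
    have rg : reads_le s0 (Z M) g by rewrite /= s01; exact: stackZ.
    exists (eval_time s0 g).+1; first by apply: exec_while_false; rewrite /= s01.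
    by move: (eval_time_le rg); rewrite /I /K [expr_size _]/=; lia.
  have szs := stackZ _ _ el.
  have rg : reads_le s0 (Z M) g by rewrite /= s01.
  have r1 : reads_le s0 (Z M) (ENode (ENode (EFst (EFst (Var 1)))
      (EFst (ESnd (EFst (Var 1))))) (EFst (ESnd (ESnd (EFst (Var 1)))))).
    by rewrite [reads_le _ _ _]/= s01 szs.
  have e1 := assign s0 0 _ r1 isT.
  set s1 := update _ _ _ in e1.
  have s11 : s1 1 = s0 1 by [].
  have s10 : s1 0 = enc (x, foldl (step x) (init x) l1, y).
    by rewrite /s1 /update /= s01.
  have [s2 [e2 o2 p2]] : exists s', [/\ exec_le cs s1 (poly_bound a (2 * Z M)) s',
      s' 0 = enc (step x (foldl (step x) (init x) l1) y) & s' 1 = s1 1].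
    apply: (computes_exec hs s10); rewrite s11 s01 !esize_pair.
    rewrite mul2n -addnn leq_add //.
    move: szs; rewrite [data_size _]/= -/(esize x) -/(esize y).
    by rewrite -/(esize (foldl _ _ _)); lia.
  have el' : l x = rcons l1 y ++ l2 by rewrite cat_rcons.
  have fr : step x (foldl (step x) (init x) l1) y =
            foldl (step x) (init x) (rcons l1 y) by rewrite -cats1 foldl_cat.
  have r3 : reads_le s2 (Z M) (ENode (ENode (EFst (EFst (Var 1)))
   (ENode (Var 0) (ESnd (ESnd (ESnd (EFst (Var 1))))))) (ESnd (Var 1))).
    rewrite [reads_le _ _ _]/= p2 s11 s01 szs o2 fr /=.
    rewrite -/(esize (foldl _ _ _)) !andbT.
    by apply: leq_trans (acc _ _ el') _; rewrite /Z; lia.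
  have e3 := assign s2 1 _ r3 isT.
  set s3 := update _ _ _ in e3.
  have s31 : s3 1 = Node (enc (x, (foldl (step x) (init x) (rcons l1 y), l2))) (s 1).
    by rewrite /s3 /update /= p2 s11 s01 o2 -fr.
  have [s4 [t4 e4 l4] s41] := IH _ _ el' s31.
  exists s4 => //.
  have [t e l5] := exec_le_seq e1 (exec_le_seq e2 e3).
  exists (eval_time s0 g + t + t4).+1.
    by apply: exec_while_true e e4; rewrite /= s01.
  move: (eval_time_le rg); rewrite [size _]/= mulSn {1}/I /K [expr_size _]/=.
  by move: l5; rewrite /K; lia.
have [s1 [e1 o1 p1]] := computes_exec hp sx (leqnn M).
have r2 : reads_le s1 (Z M) (ENode (Var 0) (Var 1)).
  rewrite /= o1 p1 /= -/(esize x) -/(esize (init x)).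
  rewrite seqE /Z.
  by apply/andP; split; lia.
have e2 := assign s1 1 _ r2 isT.
set s2 := update _ _ _ in e2.
have s21 : s2 1 = Node (enc (x, (init x, l x))) (s 1).
  by rewrite /s2 /update /= o1 p1.
have [s3 e3 s31] := run_loop (l x) [::] s2 erefl s21.
have szs := stackZ (l x) [::] (esym (cats0 _)).
have r4 : reads_le s3 (Z M) (EFst (ESnd (EFst (Var 1)))).
  by rewrite [reads_le _ _ _]/= s31.
have e4 := assign s3 0 _ r4 isT.
set s4 := update _ _ _ in e4.
have s41 : s4 1 = s3 1 by [].
have r5 : reads_le s4 (Z M) (ESnd (Var 1)).
  by rewrite [reads_le _ _ _]/= s41 s31.
have e5 := assign s4 1 _ r5 isT.
have szl : size (l x) <= poly_bound d M.
  have : size (l x) <= esize (l x).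
    by elim: (l x) => //= y l' IH; rewrite esize_cons; lia.
  by lia.
eexists; split.
- apply: exec_leW; last first.
    apply: (exec_le_seq e1); apply: (exec_le_seq e2); apply: (exec_le_seq e3).
    exact: (exec_le_seq e4 e5).
  have : (size (l x)).+1 * I M <= (poly_bound d M + 1) * I M.
    by rewrite leq_mul // addn1.
  by lia.
- by rewrite /s4 /update /= s31.
- by rewrite /update /= s41 s31.
Qed.

End Foldl.

(** * Polynomial-time list functions *)

Section FoldlGrow.
Context {G A B : Type} {eG : encodable G} {eA : encodable A} {eB : encodable B}.

(** Growth that is additive, by an amount depending on [x] and [a] only, sums to a polynomial over
    the list. [Inv] serves steps whose growth is under control only along the iteration: a round can
    enlarge every cache, and the invariant fixes their number. *)
Lemma poly_foldl_inv (Inv : G -> B -> Prop) (step : G -> B -> A -> B)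
    (init : G -> B) (l : G -> seq A) gr :
  poly (fun y : G * B * A => step y.1.1 y.1.2 y.2) -> poly init -> poly l ->
  pbd gr -> (forall x, Inv x (init x)) ->
  (forall x b a, Inv x b -> Inv x (step x b a) /\
     esize (step x b a) <= esize b + gr (esize x + esize a)) ->
  poly (fun x => foldl (step x) (init x) (l x)).
Proof.
move=> ps p0 pl [c grc] I0 grow.
have [_ [d [_ sz0]]] := p0.
have [_ [e [_ szl]]] := pl.
apply: (@poly_foldl _ _ _ _ _ _ step init l
  (fun M => poly_bound d M + poly_bound e M * poly_bound c (M + poly_bound e M)));
  try by pbd_tac.
move=> x l1 l2 el /=.
have [L Lx] : exists2 L, esize (l x) = L & L <= poly_bound e (esize x).
  by exists (esize (l x)).
have szl1 : esize l1 <= L.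
  rewrite -Lx el; elim: (l1) => [|a s IH] /=; first exact: esize_gt0.
  by rewrite !esize_cons; lia.
move=> LL; have: Inv x (init x) := I0 x.
have : size l1 <= poly_bound e (esize x).
  apply: leq_trans LL; apply: leq_trans szl1.
  by elim: (l1) => //= a s IH; rewrite esize_cons; lia.
have {el Lx szl1}: forall a, List.In a l1 -> esize a <= poly_bound e (esize x).
  move=> a ain; apply: leq_trans LL; apply: leq_trans szl1.
  elim: (l1) ain => //= a' s IH [->|/IH]; rewrite esize_cons; lia.
set E := poly_bound e _; set P := poly_bound c _ => inE sz1 Ii.
have {sz1 LL L}: size l1 * P <= E * P by rewrite leq_mul.
have szf : esize (foldl (step x) (init x) l1) <= esize (init x) + size l1 * P.
  elim: l1 (init x) Ii inE => [|a s IH] b Ib inE /=; first by rewrite addn0.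
have [Ib' sb] := grow x b a Ib.
have aE : esize a <= E by apply: inE; left.
apply: leq_trans (IH _ Ib' _) _; first by move=> a' ain; apply: inE; right.
have : gr (esize x + esize a) <= P.
  by apply: leq_trans (grc _) _; apply: poly_bound_mono; rewrite // leq_add2l.
  by lia.
by move=> szP; move: (sz0 x); lia.
Qed.

Lemma poly_foldl_grow (step : G -> B -> A -> B) (init : G -> B)
    (l : G -> seq A) gr :
  poly (fun y : G * B * A => step y.1.1 y.1.2 y.2) -> poly init -> poly l ->
  pbd gr ->
  (forall x b a, esize (step x b a) <= esize b + gr (esize x + esize a)) ->
  poly (fun x => foldl (step x) (init x) (l x)).
Proof.
move=> ps p0 pl pg grow.
by apply: (@poly_foldl_inv (fun _ _ => True) step init l _ ps p0 pl pg).
Qed.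

End FoldlGrow.

Ltac var_tac := solve [repeat first [exact: poly_id | apply: poly_fst | apply: poly_snd]].

Section Lists.
Context {G A B : Type} {eG : encodable G} {eA : encodable A} {eB : encodable B}.

Lemma poly_rev (l : G -> seq A) : poly l -> poly (fun x => rev (l x)).
Proof.
move=> pl; apply: (poly_ext (f := fun x => foldl (fun s a => a :: s) [::] (l x))).
  by move=> x; rewrite /rev; elim: (l x) [::] => //= a s IH acc; rewrite IH.
apply: (@poly_foldl_grow _ _ _ _ _ _ (fun _ s a => a :: s) _ _ (fun M => M + 1)) => //;
  try by pbd_tac.
- by apply: poly_cons; var_tac.
- exact: poly_const.
- by move=> x b a; rewrite esize_cons; lia.
Qed.

End Lists.

Section Map.
Context {G A B : Type} {eG : encodable G} {eA : encodable A} {eB : encodable B}.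

Lemma poly_map (h : G -> A -> B) (l : G -> seq A) :
  poly (fun y : G * A => h y.1 y.2) -> poly l -> poly (fun x => map (h x) (l x)).
Proof.
move=> ph pl.
apply: (poly_ext (f := fun x => rev (foldl (fun s a => h x a :: s) [::] (l x)))).
  move=> x; rewrite -[RHS]revK; congr rev.
  rewrite /rev; by elim: (l x) [::] => //= a s IH acc; rewrite IH.
have [_ [c [_ sz]]] := ph.
apply: poly_rev.
apply: (@poly_foldl_grow _ _ _ _ _ _ (fun x s a => h x a :: s) _ _
   (fun M => poly_bound c (M + 1) + 1)) => //; try by pbd_tac.
- apply: poly_cons; last by var_tac.
  by apply: (poly_comp (g := fun y : G * seq B * A => (y.1.1, y.2))) ph _;
    apply: poly_pair; var_tac.
- exact: poly_const.
- move=> x b a; rewrite esize_cons; have := sz (x, a); rewrite esize_pair /= !addn1.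
  by lia.
Qed.

End Map.

Section ListFunctions.
Context {G A B : Type} {eG : encodable G} {eA : encodable A} {eB : encodable B}.

Lemma poly_filter (p : G -> A -> bool) (l : G -> seq A) :
  poly (fun y : G * A => p y.1 y.2) -> poly l ->
  poly (fun x => filter (p x) (l x)).
Proof.
move=> pp pl.
apply: (poly_ext (f := fun x =>
    rev (foldl (fun s a => if p x a then a :: s else s) [::] (l x)))).
  move=> x; rewrite -[RHS]revK; congr rev.
  by rewrite /rev; elim: (l x) [::] => //= a s IH acc; rewrite IH; case: (p x a).
apply: poly_rev.
apply: (@poly_foldl_grow _ _ _ _ _ _ (fun x s a => if p x a then a :: s else s)
  _ _ (fun M => M + 1)) => //; try by pbd_tac.
- apply: poly_if; [|by apply: poly_cons; var_tac|by var_tac].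
  by apply: (poly_comp (g := fun y : G * seq A * A => (y.1.1, y.2))) pp _;
    apply: poly_pair; var_tac.
- exact: poly_const.
- by move=> x b a; case: (p x a); rewrite ?esize_cons; lia.
Qed.

Lemma poly_cat (s t : G -> seq A) : poly s -> poly t -> poly (fun x => s x ++ t x).
Proof.
move=> ps pt.
apply: (poly_ext (f := fun x => foldl (fun u a => a :: u) (t x) (rev (s x)))).
  by move=> x; rewrite foldl_rev; elim: (s x) => //= a u ->.
apply: (@poly_foldl_grow _ _ _ _ _ _ (fun _ s a => a :: s) _ _ (fun M => M + 1)) => //;
  try by pbd_tac.
- by apply: poly_cons; var_tac.
- exact: poly_rev.
- by move=> x b a; rewrite esize_cons; lia.
Qed.

Lemma esize_cat (s t : seq A) : (esize (s ++ t)).+1 = esize s + esize t.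
Proof. by elim: s => //= a s IH; rewrite !esize_cons; lia. Qed.

Lemma poly_size (l : G -> seq A) : poly l -> poly (fun x => size (l x)).
Proof.
move=> pl; apply: (poly_ext (f := fun x => foldl (fun n _ => n.+1) 0 (l x))).
  move=> x; rewrite -[RHS]add0n; elim: (l x) 0 => //= [|a s IH] n; first by rewrite addn0.
  by rewrite IH addSnnS.
apply: (@poly_foldl_grow _ _ _ _ _ _ (fun _ n _ => n.+1) _ _ (fun M => 2)) => //;
  try by pbd_tac.
- by apply: poly_succ; var_tac.
- exact: poly_const.
- by move=> x b a; rewrite !esize_nat; lia.
Qed.

Lemma poly_iter_grow (Inv : G -> B -> Prop) (n : G -> nat) (f : G -> B -> B)
    (b : G -> B) gr :
  poly n -> poly (fun y : G * B => f y.1 y.2) -> poly b -> pbd gr ->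
  (forall x, Inv x (b x)) ->
  (forall x c, Inv x c ->
     Inv x (f x c) /\ esize (f x c) <= esize c + gr (esize x)) ->
  poly (fun x => iter (n x) (f x) (b x)).
Proof.
move=> pn pf pb [d grd] I0 grow.
apply: (poly_ext (f := fun x => foldl (fun c _ => f x c) (b x) (nseq (n x) false))).
  move=> x; elim: (n x) (b x) => //= m IH c.
  by rewrite IH -iterSr.
apply: (@poly_foldl_inv _ _ _ _ _ _ Inv (fun x c _ => f x c) _ _
  (fun M => poly_bound d M)) => //; try by pbd_tac.
- by apply: (poly_comp (g := fun y : G * B * bool => (y.1.1, y.1.2))) pf _;
    apply: poly_pair; var_tac.
(* [m] and [nseq m false] are encoded by the same tree. *)
- apply: (poly_comp (f := fun m => nseq m false)) pn.
  apply: (@poly_expr _ _ _ _ _ (Var 0)) => // s m /= ->.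
  by elim: m => //= m ->.
- move=> x c a Ic /=; have [Ic' sz] := grow _ _ Ic; split=> //.
  apply: leq_trans sz _; rewrite leq_add2l; apply: leq_trans (grd _) _.
  by apply: poly_bound_mono; rewrite // leq_addr.
Qed.
End ListFunctions.

Section Nats.
Context {G A : Type} {eG : encodable G} {eA : encodable A}.

Lemma poly_add (m n : G -> nat) : poly m -> poly n -> poly (fun x => m x + n x).
Proof.
move=> pm pn; apply: (poly_ext (f := fun x => iter (m x) succn (n x))).
  by move=> x; rewrite iter_succn addnC.
apply: (@poly_iter_grow _ _ _ _ (fun _ _ => True) _ (fun _ => succn) _ (fun=> 2)) => //.
- by apply: poly_succ; var_tac.
- exact: pbd_const.
- by move=> x c _; rewrite !esize_nat; split=> //; lia.
Qed.

Lemma poly_sub (m n : G -> nat) : poly m -> poly n -> poly (fun x => m x - n x).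
Proof.
move=> pm pn; apply: (poly_ext (f := fun x => iter (n x) predn (m x))).
  by move=> x; elim: (n x) => //= [|k ->]; rewrite ?subn0 ?subnS.
apply: (@poly_iter_grow _ _ _ _ (fun _ _ => True) _ (fun _ => predn) _ (fun=> 2)) => //.
- by apply: poly_pred; var_tac.
- exact: pbd_const.
- by move=> x c _; rewrite !esize_nat; split=> //; lia.
Qed.

Lemma poly_maxn (m n : G -> nat) : poly m -> poly n -> poly (fun x => maxn (m x) (n x)).
Proof.
move=> pm pn; apply: (poly_ext (f := fun x => m x + (n x - m x))).
  by move=> x; rewrite maxnE.
by apply: poly_add => //; apply: poly_sub.
Qed.

Lemma poly_leq (m n : G -> nat) : poly m -> poly n -> poly (fun x => m x <= n x).
Proof.
by move=> pm pn; apply: poly_eqn; [exact: poly_sub | exact: poly_const].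
Qed.

End Nats.

Section NatsAndLists.
Context {G A : Type} {eG : encodable G} {eA : encodable A}.

Lemma poly_mul (m n : G -> nat) : poly m -> poly n -> poly (fun x => m x * n x).
Proof.
move=> pm pn; apply: (poly_ext (f := fun x => iter (m x) (addn (n x)) 0)).
  by move=> x; rewrite iter_addn_0 mulnC.
have [_ [c [_ sz]]] := pn.
apply: (@poly_iter_grow _ _ _ _ (fun _ _ => True) _ (fun x => addn (n x)) _
  (poly_bound c)) => //.
- apply: poly_add; last by var_tac.
  by apply: (poly_comp (g := fst)) pn _; var_tac.
- exact: poly_const.
- exact: pbd_poly_bound.
- by move=> x m' _; split=> //; move: (sz x); rewrite !esize_nat; lia.
Qed.

Lemma poly_sumn (l : G -> seq nat) : poly l -> poly (fun x => sumn (l x)).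
Proof.
move=> pl; apply: (poly_ext (f := fun x => foldl addn 0 (l x))).
  by move=> x; rewrite sumnE foldlE /= big_cons add0n.
apply: (@poly_foldl_grow _ _ _ _ _ _ (fun _ => addn) _ _ (fun M => M)) => //;
  try by pbd_tac.
- by apply: poly_add; var_tac.
- exact: poly_const.
- by move=> x b a; rewrite !esize_nat; lia.
Qed.

Lemma poly_mem (q : G -> nat) (l : G -> seq nat) : poly q -> poly l ->
  poly (fun x => q x \in l x).
Proof.
move=> pq pl.
apply: (poly_ext (f := fun x => ~~ nilp [seq a <- l x | a == q x])).
  move=> x; rewrite -has_pred1 has_filter; congr (~~ _).
  by rewrite /nilp -size_eq0; congr (size _ == 0); apply: eq_filter => a /=.
apply: poly_neg; apply: poly_nilp; apply: poly_filter => //.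
apply: poly_eqn; first by var_tac.
by apply: (poly_comp (g := fst)) pq _; var_tac.
Qed.

Lemma poly_has (p : G -> A -> bool) (l : G -> seq A) :
  poly (fun y : G * A => p y.1 y.2) -> poly l -> poly (fun x => has (p x) (l x)).
Proof.
move=> pp pl.
apply: (poly_ext (f := fun x => ~~ nilp (filter (p x) (l x)))).
  by move=> x; rewrite has_count /nilp size_filter lt0n.
by apply: poly_neg; apply: poly_nilp; apply: poly_filter.
Qed.

Lemma poly_flatten (l : G -> seq (seq A)) : poly l -> poly (fun x => flatten (l x)).
Proof.
move=> pl; apply: (poly_ext (f := fun x => foldl cat [::] (l x))).
  by move=> x; rewrite -[RHS]cat0s; elim: (l x) [::] => /= [|a s IH] u;
    rewrite ?cats0 // IH catA.
apply: (@poly_foldl_grow _ _ _ _ _ _ (fun _ => cat) _ _ (fun M => M)) => //;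
  try by pbd_tac.
- by apply: poly_cat; var_tac.
- exact: poly_const.
- move=> x b a /=; have := @esize_cat A eA b a; lia.
Qed.

(** The new entry [size s] depends on the accumulator, so the additive growth lemmas do not apply;
    the accumulators of all prefixes are bounded directly, with [N] bounding the length. *)
Lemma poly_iota (n : G -> nat) : poly n -> poly (fun x => iota 0 (n x)).
Proof.
move=> pn.
apply: (poly_ext (f := fun x =>
    rev (iter (n x) (fun s : seq nat => size s :: s) [::]))).
  move=> x.
  have h m : iter m (fun s : seq nat => size s :: s) [::] = rev (iota 0 m).
    elim: m => // m IH; rewrite iterS IH size_rev size_iota.
    by rewrite -[m.+1 in RHS]addn1 iotaD rev_cat.
  by rewrite h revK.
apply: poly_rev.
have h m : iter m (fun s : seq nat => size s :: s) [::] = rev (iota 0 m).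
  elim: m => // m IH; rewrite iterS IH size_rev size_iota.
  by rewrite -[m.+1 in RHS]addn1 iotaD rev_cat.
apply: (poly_ext (f := fun x =>
    foldl (fun s _ => size s :: s) [::] (nseq (n x) false))).
  by move=> x; elim: (n x) [::] => //= m IH s; rewrite IH -iterSr.
have [_ [c [_ sz]]] := pn.
apply: (@poly_foldl _ _ _ _ _ _ (fun _ s _ => size s :: s) _ _
  (fun M => poly_bound c M * (2 * poly_bound c M + 2) + 3)); try by pbd_tac.
- by apply: poly_cons; [apply: poly_size|]; var_tac.
- exact: poly_const.
- apply: (poly_comp (f := fun m => nseq m false)) pn.
  apply: (@poly_expr _ _ _ _ _ (Var 0)) => // s m /= ->.
  by elim: m => //= m ->.
move=> x l1 l2 el /=.
have szl1 : size l1 <= poly_bound c (esize x).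
  apply: leq_trans (_ : size l1 <= n x) _.
    by rewrite -[n x](size_nseq _ false) el size_cat leq_addr.
  by apply: leq_trans (sz x); rewrite esize_nat -addnn; lia.
move: (poly_bound c _) szl1 => N szN.
have [sf szf] : size (foldl (fun s _ => size s :: s) [::] l1) = size l1 /\
    esize (foldl (fun s _ => size s :: s) [::] l1) <= size l1 * (2 * N + 2) + 1.
  elim/last_ind: l1 szN {el} => // s a IH; rewrite size_rcons => szN.
  have [IH1 IH2] := IH (ltnW szN).
  rewrite -cats1 foldl_cat /= esize_cons IH1; split=> //.
  by rewrite esize_nat; lia.
by apply: leq_trans szf _; rewrite leq_add // leq_mul.
Qed.
End NatsAndLists.

(** * The algorithm *)

Ltac poly_step := cbv beta; lazymatch goal with
  | |- poly (@fst _ _) => exact: (poly_fst (f := id) poly_id)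
  | |- poly (@snd _ _) => exact: (poly_snd (f := id) poly_id)
  | |- poly (fun x => x) => exact: poly_id
  | |- poly (fun x => fst (@?f x)) => apply: (poly_fst (f := f))
  | |- poly (fun x => snd (@?f x)) => apply: (poly_snd (f := f))
  | |- poly (fun x => pair (@?f x) (@?g x)) => apply: (poly_pair (f := f) (g := g))
  | |- poly (fun x => if _ then _ else _) => apply: poly_if
  | |- poly (fun x => map (@?h x) (@?l x)) => apply: (poly_map (h := h) (l := l))
  | |- poly (fun x => filter (@?h x) (@?l x)) => apply: (poly_filter (p := h) (l := l))
  | |- poly (fun x => has (@?h x) (@?l x)) => apply: (poly_has (p := h) (l := l))
  | |- poly (fun x => in_mem (@?q x) (@mem _ _ (@?l x))) =>
      apply: (poly_mem (q := q) (l := l))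
  | |- poly (fun x => flatten (@?l x)) => apply: (poly_flatten (l := l))
  | |- poly (fun x => size (@?l x)) => apply: (poly_size (l := l))
  | |- poly (fun x => sumn (@?l x)) => apply: (poly_sumn (l := l))
  | |- poly (fun x => nilp (@?l x)) => apply: (poly_nilp (f := l))
  | |- poly (fun x => behead (@?l x)) => apply: (poly_behead (f := l))
  | |- poly (fun x => iota 0 (@?n x)) => apply: (poly_iota (n := n))
  | |- poly (fun x => head (@?f x) (@?l x)) => apply: (poly_head (f := f) (l := l))
  | |- poly (fun x => cons (@?f x) (@?l x)) => apply: (poly_cons (f := f) (g := l))
  | |- poly (fun x => cat (@?f x) (@?l x)) => apply: (poly_cat (s := f) (t := l))
  | |- poly (fun x => negb (@?f x)) => apply: (poly_neg (f := f))
  | |- poly (fun x => andb (@?f x) (@?g x)) => apply: (poly_and (f := f) (g := g))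
  | |- poly (fun x => @eq_op _ (@?f x) (@?g x)) => apply: (poly_eqn (f := f) (g := g))
  | |- poly (fun x => leq (@?f x) (@?g x)) => apply: (poly_leq (m := f) (n := g))
  | |- poly (fun x => addn (@?f x) (@?g x)) => apply: (poly_add (m := f) (n := g))
  | |- poly (fun x => subn (@?f x) (@?g x)) => apply: (poly_sub (m := f) (n := g))
  | |- poly (fun x => muln (@?f x) (@?g x)) => apply: (poly_mul (m := f) (n := g))
  | |- poly (fun x => maxn (@?f x) (@?g x)) => apply: (poly_maxn (m := f) (n := g))
  | |- poly (fun x => S (@?f x)) => apply: (poly_succ (f := f))
  | |- poly (fun x => _) => exact: poly_const
  end.

(* An agent is a pair (reserve, pages).  A cache is the list of its pages, of
   which only membership matters.  An ensemble lists pairs (index, cache). *)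
Definition cnt (V : seq nat) (a : nat * seq nat) := size [seq q <- a.2 | q \in V].

Definition load (ags : seq (nat * seq nat)) V :=
  sumn [seq maxn (cnt V a) a.1 | a <- ags].
Definition lack (ags : seq (nat * seq nat)) V :=
  sumn [seq a.1 - cnt V a | a <- ags].
Definition badness k ags V := lack ags V + (load ags V - k).
Definition total_badness k ags (Vs : seq (nat * seq nat)) :=
  sumn [seq badness k ags c.2 | c <- Vs].
Definition pages (ags : seq (nat * seq nat)) := flatten [seq a.2 | a <- ags].
Definition add (q : nat) (V : seq nat) : seq nat := if q \in V then V else q :: V.
Definition del (q : nat) (V : seq nat) : seq nat := [seq y <- V | y != q].
Definition move q i j (Vs : seq (nat * seq nat)) :=
  [seq (c.1, if c.1 == i then del q c.2 else
             if c.1 == j then add q c.2 else c.2) | c <- Vs].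
Definition moves ags (Vs : seq (nat * seq nat)) :=
  flatten [seq flatten [seq [seq move q c.1 d.1 Vs | d <- Vs & q \notin d.2]
                       | c <- Vs & q \in c.2] | q <- pages ags].
Definition missing q (Vs : seq (nat * seq nat)) :=
  size [seq c <- Vs | q \notin c.2].
(** If no cache contains [q], the default index 0 is harmless, since [del] then removes nothing. *)
Definition expel q (Vs : seq (nat * seq nat)) :=
  [seq (c.1, if c.1 == (head (0, [::]) [seq c <- Vs | q \in c.2]).1
             then del q c.2 else c.2) | c <- Vs].
(* [maxn 1 _] starts the doubling at a page missing nowhere. *)
Definition thin q Vs := iter (maxn 1 (missing q Vs)) (expel q) Vs.
Definition thin_all U Vs := foldl (fun Ws q => thin q Ws) Vs U.
Definition hot ags p (Vs : seq (nat * seq nat)) :=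
  flatten [seq [seq q <- a.2 | (q != p) && has (fun c => a.1 < cnt c.2 a) Vs]
          | a : nat * seq nat <- ags].
Definition better k ags Vs :=
  [seq Ws <- moves ags Vs | total_badness k ags Ws < total_badness k ags Vs].
Definition overloaded k ags (Vs : seq (nat * seq nat)) :=
  size Vs * k < sumn [seq load ags c.2 | c <- Vs].
(** With no improving move and no overload a round changes nothing, so [serve] can run a fixed
    number of rounds without testing for termination. *)
Definition round k ags p Vs :=
  head (if overloaded k ags Vs then thin_all (hot ags p Vs) Vs else Vs)
       (better k ags Vs).
Definition insert p (Vs : seq (nat * seq nat)) :=
  [seq (c.1, add p c.2) | c <- Vs].
(* The number of rounds bounds the potential: see [potential_bound]. *)
Definition serve k ags p Vs :=
  iter (20 * size Vs * size Vs * (size (pages ags)).+1) (round k ags p)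
       (insert p Vs).
Definition lookup i (Vs : seq (nat * seq nat)) :=
  (head (0, [::]) [seq c <- Vs | c.1 == i]).2.
(* Builds a uniform [v < M], where [M] is the least power of 2 above [k]; the
   test on [v] always succeeds and only bounds the growth on arbitrary inputs. *)
Definition draw_step k (vM : nat * nat) (b : bool) :=
  if (vM.2 <= k) && (vM.1 <= k)
  then (vM.1 + vM.1 + (if b then 1 else 0), vM.2 + vM.2) else vM.
Definition draw k (w : seq bool) := foldl (draw_step k) (0, 1) w.
(** The size of the cache is measured through [cnt], because the list [X], initially [V ++ C], may
    repeat pages. *)
Definition evict k ags (V X : seq nat) (aq : nat * seq nat * nat) :=
  if [&& aq.2 \notin V, k < sumn [seq cnt X a | a <- ags] & aq.1.1 < cnt X aq.1]
  then del aq.2 X else X.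
Definition slots (ags : seq (nat * seq nat)) :=
  flatten [seq [seq (a, q) | q <- a.2] | a <- ags].
(** Filtering [iota] lists the pages in increasing order, which is that of [enum]; the program thus
    outputs literally the [enc_set] of the new cache. *)
Definition refit k ags (V C : seq nat) :=
  [seq q <- iota 0 (size (pages ags))
     | q \in foldl (evict k ags V) (V ++ C) (slots ags)].
(* The memory is the ensemble preceded by an entry whose index is the chosen one
   and whose cache is a dummy; it is empty before the first request. *)
Definition boot k (C : seq nat) w (mem : seq (nat * seq nat)) :=
  if nilp mem
  then ((draw k w).1, [::]) :: [seq (i, C) | i <- iota 0 (draw k w).2]
  else mem.
Definition respond k ags p (C : seq nat) (st : seq (nat * seq nat)) :=
  (((head (0, [::]) st).1, [::]) :: serve k ags p (behead st),
   refit k ags (lookup (head (0, [::]) st).1 (serve k ags p (behead st))) C).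

(** * Size bounds and polynomial time of the algorithm *)

Section Sizes.
Context {A : Type} {eA : encodable A}.

Lemma esize_filter (p : pred A) (s : seq A) : esize (filter p s) <= esize s.
Proof. by elim: s => //= a s IH; case: (p a); rewrite !esize_cons; lia. Qed.

Lemma size_le_esize (s : seq A) : size s <= esize s.
Proof. by elim: s => //= a s IH; rewrite esize_cons; lia. Qed.

End Sizes.

Lemma esize_map_snd (f : nat * seq nat -> seq nat) m (Vs : seq (nat * seq nat)) :
  (forall c, esize (f c) <= esize c.2 + m) ->
  esize [seq (c.1, f c) | c <- Vs] <= esize Vs + size Vs * m.
Proof.
move=> h; elim: Vs => //= c Vs IH; rewrite !esize_cons.
rewrite [in X in _ <= X](surjective_pairing c) !esize_pair.
by have := h c; lia.
Qed.

Lemma esize_del q (V : seq nat) : esize (del q V) <= esize V.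
Proof. exact: esize_filter. Qed.

Lemma esize_expel q Vs : esize (expel q Vs) <= esize Vs.
Proof.
rewrite -[X in _ <= X]addn0 -(muln0 (size Vs)); apply: esize_map_snd => c.
by case: ifP => _; rewrite addn0 // esize_del.
Qed.

Lemma esize_thin q Vs : esize (thin q Vs) <= esize Vs.
Proof.
rewrite /thin; elim: (maxn _ _) => //= n IH.
exact: leq_trans (esize_expel _ _) IH.
Qed.

Lemma size_thin q Vs : size (thin q Vs) = size Vs.
Proof. by rewrite /thin; elim: (maxn _ _) => //= n <-; rewrite size_map. Qed.

Lemma esize_thin_all U Vs : esize (thin_all U Vs) <= esize Vs.
Proof.
elim: U Vs => //= q U IH Vs.
exact: leq_trans (IH _) (esize_thin _ _).
Qed.

Lemma size_thin_all U Vs : size (thin_all U Vs) = size Vs.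
Proof. by elim: U Vs => //= q U IH Vs; rewrite IH size_thin. Qed.

Lemma movesP ags Vs Ws : Ws \in moves ags Vs ->
  exists q c d, [/\ Ws = move q c.1 d.1 Vs, q \in pages ags,
    c \in Vs /\ q \in c.2 & d \in Vs /\ q \notin d.2].
Proof.
case/flattenP => s /mapP[q qin ->] /flattenP[t /mapP[c]].
rewrite mem_filter => /andP[qc cin] -> /mapP[d].
rewrite mem_filter => /andP[qd din] ->.
by exists q, c, d.
Qed.

Lemma roundP k ags p Vs : let Ws := round k ags p Vs in
  [\/ Ws \in better k ags Vs,
      [/\ better k ags Vs = [::], overloaded k ags Vs &
          Ws = thin_all (hot ags p Vs) Vs]
    | [/\ better k ags Vs = [::], ~~ overloaded k ags Vs & Ws = Vs]].
Proof.
rewrite /round; case e: (better k ags Vs) => [|Ws s] /=.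
  by case: ifP => o; [apply: Or32|apply: Or33].
by apply: Or31; rewrite inE eqxx.
Qed.

Lemma esize_mem_flat q (ags : seq (nat * seq nat)) :
  q \in pages ags -> esize q <= esize ags.
Proof.
case/flattenP => s /mapP[a ain ->] qa.
have : esize a <= esize ags.
  elim: ags ain => //= b ags IH; rewrite inE esize_cons => /orP[/eqP->|/IH]; lia.
apply: leq_trans; rewrite [in X in _ <= X](surjective_pairing a) esize_pair.
have : esize q <= esize a.2; last by lia.
elim: (a.2) qa => //= b s' IH; rewrite inE esize_cons => /orP[/eqP->|/IH]; lia.
Qed.

Lemma esize_add q (V : seq nat) : esize (add q V) <= esize V + (esize q).+1.
Proof. by rewrite /add; case: ifP => _; rewrite ?esize_cons; lia. Qed.

Lemma esize_round k ags p Vs :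
  size (round k ags p Vs) = size Vs /\
  esize (round k ags p Vs) <= esize Vs + size Vs * (esize ags).+1.
Proof.
case: (roundP k ags p Vs) => [|[_ _ ->]|[_ _ ->]].
- rewrite mem_filter => /andP[_ /movesP[q [c [d [-> qin _ _]]]]].
  split; first by rewrite size_map.
  apply: leq_trans (esize_map_snd (m := (esize q).+1) _ _) _ => [c'|].
    case: ifP => _; first by apply: leq_trans (esize_del _ _) _; rewrite leq_addr.
    by case: ifP => _; [exact: esize_add | rewrite leq_addr].
  by rewrite leq_add2l leq_mul // ltnS esize_mem_flat.
- by rewrite size_thin_all; split=> //; apply: leq_trans (esize_thin_all _ _) (leq_addr _ _).
- by rewrite leq_addr.
Qed.

Lemma poly_thin : poly (fun y : nat * seq (nat * seq nat) => thin y.1 y.2).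
Proof.
apply: (@poly_iter_grow _ _ _ _ (fun _ _ => True) _ (fun y => expel y.1) _
  (fun=> 0)) => //.
- by rewrite /missing; repeat poly_step.
- by rewrite /expel /del; repeat poly_step.
- by repeat poly_step.
- exact: pbd_const.
- by move=> y c _; split=> //; rewrite addn0 esize_expel.
Qed.

Lemma poly_thin_all G {eG : encodable G} (U : G -> seq nat) Vs :
  poly U -> poly Vs -> poly (fun x => thin_all (U x) (Vs x)).
Proof.
apply: (poly_comp2 (h := fun y => thin_all y.1 y.2)).
apply: (@poly_foldl_grow _ _ _ _ _ _ (fun _ Ws q => thin q Ws) _ _ (fun=> 0)).
- apply: (poly_comp2 poly_thin); by repeat poly_step.
- by repeat poly_step.
- by repeat poly_step.
- exact: pbd_const.
- by move=> y b a; rewrite addn0 esize_thin.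
Qed.

Lemma poly_serve : poly (fun y : nat * seq (nat * seq nat) * nat * seq (nat * seq nat) =>
  serve y.1.1.1 y.1.1.2 y.1.2 y.2).
Proof.
apply: (@poly_iter_grow _ _ _ _ (fun y c => size c = size y.2) _
  (fun y => round y.1.1.1 y.1.1.2 y.1.2) _ (fun M => M * (M + 1))).
- by rewrite /pages; repeat poly_step.
- rewrite /round; apply: poly_head.
    apply: poly_if; first by rewrite /overloaded /load /cnt; repeat poly_step.
      apply: poly_thin_all; first by rewrite /hot /cnt; repeat poly_step.
      by repeat poly_step.
    by repeat poly_step.
  by rewrite /better /moves /total_badness /badness /lack /load /cnt /move /pages
       /del /add; repeat poly_step.
- by rewrite /insert /add; repeat poly_step.
- by pbd_tac.
- by move=> y; rewrite size_map.
- move=> [[[k ags] p] Vs] c /= sc; have [s1 s2] := esize_round k ags p c.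
  split; first by rewrite s1.
  apply: leq_trans s2 _; rewrite leq_add2l leq_mul //.
    by rewrite sc !esize_pair; apply: leq_trans (size_le_esize _) _; lia.
  by rewrite !esize_pair; lia.
Qed.

Lemma poly_draw G {eG : encodable G} (k : G -> nat) w :
  poly k -> poly w -> poly (fun x => draw (k x) (w x)).
Proof.
apply: (poly_comp2 (h := fun y => draw y.1 y.2)).
apply: (@poly_foldl_grow _ _ _ _ _ _
   (fun y : nat * seq bool => draw_step y.1) (fun=> (0, 1)) _
   (fun M => 4 * M + 4)).
- by rewrite /draw_step; repeat poly_step.
- by repeat poly_step.
- by repeat poly_step.
- by pbd_tac.
- move=> [k' w'] [v M] b; rewrite /draw_step /=; case: ifP; last by rewrite leq_addr.
  move=> /andP[vk Mk].
  by rewrite !esize_pair !esize_nat; case: b; lia.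
Qed.

Lemma poly_refit : poly (fun y : nat * seq (nat * seq nat) * seq nat * seq nat =>
  refit y.1.1.1 y.1.1.2 y.1.2 y.2).
Proof.
apply: poly_filter; last by rewrite /pages; repeat poly_step.
apply: poly_mem; first by repeat poly_step.
apply: (poly_comp (f := fun y : nat * seq (nat * seq nat) * seq nat * seq nat =>
   foldl (evict y.1.1.1 y.1.1.2 y.1.2) (y.1.2 ++ y.2) (slots y.1.1.2))); last first.
  by repeat poly_step.
apply: (@poly_foldl_grow _ _ _ _ _ _
   (fun (y : nat * seq (nat * seq nat) * seq nat * seq nat) =>
     evict y.1.1.1 y.1.1.2 y.1.2) _ _ (fun=> 0)).
- by rewrite /evict /cnt /del; repeat poly_step.
- by repeat poly_step.
- by rewrite /slots; repeat poly_step.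
- by pbd_tac.
- move=> y b a; rewrite /evict addn0; case: ifP => // _; exact: esize_del.
Qed.

(** The pairs are nested as in [enc_step_input], and the result as in [enc_config]. *)
Definition full (y : nat * seq (nat * seq nat) *
    (seq (nat * seq nat) * seq nat * (nat * seq bool))) :=
  respond y.1.1 y.1.2 y.2.2.1 y.2.1.2 (boot y.1.1 y.2.1.2 y.2.2.2 y.2.1.1).

Lemma poly_full : poly full.
Proof.
pose st (y : nat * seq (nat * seq nat) *
    (seq (nat * seq nat) * seq nat * (nat * seq bool))) :=
  boot y.1.1 y.2.1.2 y.2.2.2 y.2.1.1.
have pst : poly st.
  rewrite /st /boot; apply: poly_if; first by repeat poly_step.
    apply: poly_cons.
      apply: poly_pair; last by repeat poly_step.
      apply: poly_fst; apply: poly_draw; by repeat poly_step.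
    apply: poly_map; first by repeat poly_step.
    apply: poly_iota; apply: poly_snd; apply: poly_draw;
      by repeat poly_step.
  by repeat poly_step.
have ps : poly (fun y => serve y.1.1 y.1.2 y.2.2.1 (behead (st y))).
  apply: (poly_comp (g := fun y => (y.1, y.2.2.1, behead (st y))) poly_serve).
  apply: poly_pair; first by repeat poly_step.
  exact: poly_behead.
have ph : poly (fun y => (head (0, [::] : seq nat) (st y)).1).
  apply: poly_fst; apply: poly_head => //; exact: poly_const.
apply: poly_pair.
  apply: poly_cons => //; apply: poly_pair => //; exact: poly_const.
apply: (poly_comp (g := fun y => (y.1,
  lookup (head (0, [::] : seq nat) (st y)).1
    (serve y.1.1 y.1.2 y.2.2.1 (behead (st y))), y.2.1.2)) poly_refit).
apply: poly_pair; last by repeat poly_step.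
apply: poly_pair; first by repeat poly_step.
apply: (poly_comp2 (h := fun z => lookup z.1 z.2)) => //.
by rewrite /lookup; repeat poly_step.
Qed.

(** * Moving single pages *)

Lemma in_add y q V : (y \in add q V) = (y == q) || (y \in V).
Proof. by rewrite /add; case: ifP => qV; rewrite ?inE //; case: eqP => // ->. Qed.

Lemma in_del y q V : (y \in del q V) = (y != q) && (y \in V).
Proof. by rewrite mem_filter. Qed.

Lemma cnt_sum V a : cnt V a = \sum_(q <- a.2) (q \in V).
Proof.
rewrite /cnt size_filter -sum1_count big_mkcond /=.
by apply: eq_bigr => q _; case: (q \in V).
Qed.

Lemma load_sum ags V : load ags V = \sum_(a <- ags) maxn (cnt V a) a.1.
Proof. by rewrite /load sumnE big_map. Qed.

Lemma lack_sum ags V : lack ags V = \sum_(a <- ags) (a.1 - cnt V a).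
Proof. by rewrite /lack sumnE big_map. Qed.

Lemma sum_pages ags (F : nat -> nat) :
  \sum_(q <- pages ags) F q = \sum_(a <- ags) \sum_(q <- a.2) F q.
Proof. by rewrite /pages big_flatten big_map. Qed.

Lemma cnt_eq V W a : {in a.2, V =i W} -> cnt V a = cnt W a.
Proof. by move=> h; rewrite /cnt; congr size; apply: eq_in_filter. Qed.

Lemma cnt_le V W a : (forall q, q \in a.2 -> q \in V -> q \in W) -> cnt V a <= cnt W a.
Proof.
move=> h; rewrite !cnt_sum !big_seq; apply: leq_sum => q qa.
by case e: (q \in V) => //; rewrite h.
Qed.

Lemma cnt_toggle V W q a : uniq a.2 -> q \in a.2 -> q \in V -> q \notin W ->
  (forall y, y != q -> (y \in V) = (y \in W)) -> cnt V a = (cnt W a).+1.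
Proof.
move=> ua qa qV qW h; rewrite !cnt_sum !(bigD1_seq q) //= qV (negPf qW) add0n add1n.
by congr _.+1; apply: eq_bigr => y /h ->.
Qed.

Section Agents.
Variables (k : nat) (ags : seq (nat * seq nat)).
Hypothesis uniq_pages : uniq (pages ags).

Lemma agent_split a q : a \in ags -> q \in a.2 ->
  exists2 rest, perm_eq ags (a :: rest) & forall b, b \in rest -> q \notin b.2.
Proof.
move=> ain qa; exists (rem a ags); first exact: perm_to_rem.
have : uniq (pages (a :: rem a ags)).
  rewrite -(perm_uniq (s1 := pages ags)) //; apply: perm_flatten.
  by apply: perm_map; exact: perm_to_rem.
rewrite /pages /= cat_uniq => /and3P[_ /hasPn h _] b bin; apply/negP => qb.
suff /h : q \in flatten [seq a0.2 | a0 <- rem a ags] by rewrite /= qa.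
by apply/flattenP; exists b.2 => //; apply: map_f.
Qed.

Lemma agent_uniq a : a \in ags -> uniq a.2.
Proof.
move=> ain; move: uniq_pages; rewrite /pages.
elim: ags ain => //= b s IH; rewrite inE cat_uniq => /orP[/eqP->|/IH h] /and3P[u1 _ u2] //.
exact: h.
Qed.

Lemma in_pages a q : a \in ags -> q \in a.2 -> q \in pages ags.
Proof. by move=> ain qa; apply/flattenP; exists a.2 => //; apply: map_f. Qed.

Lemma pagesP q : q \in pages ags -> exists2 a, a \in ags & q \in a.2.
Proof. by case/flattenP => s /mapP[a ain ->]; exists a. Qed.

(** Only the agent [a] owns [q], so the terms of all other agents, collected in [l] and [d], are
    common to [V] and [W]. *)
Lemma toggle V W a q : a \in ags -> q \in a.2 -> q \in V -> q \notin W ->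
  (forall y, y != q -> (y \in V) = (y \in W)) ->
  exists l d, [/\ cnt V a = (cnt W a).+1,
    load ags V = maxn (cnt W a).+1 a.1 + l, load ags W = maxn (cnt W a) a.1 + l,
    lack ags V = (a.1 - (cnt W a).+1) + d & lack ags W = (a.1 - cnt W a) + d].
Proof.
move=> ain qa qV qW h; have [rest pr nq] := agent_split ain qa.
have cV := cnt_toggle (agent_uniq ain) qa qV qW h.
have cr b : b \in rest -> cnt V b = cnt W b.
  move=> bin; apply: cnt_eq => y yb; apply: h; apply: contraTneq yb => ->.
  exact: nq.
exists (\sum_(b <- rest) maxn (cnt W b) b.1), (\sum_(b <- rest) (b.1 - cnt W b)).
rewrite !load_sum !lack_sum !(perm_big _ pr) /= !big_cons cV.
by split=> //; congr (_ + _); apply: eq_big_seq => b /cr ->.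
Qed.

(** Below the reserve an added page changes only the lack, from the reserve on only the load; each
    changes by 1. *)
Lemma toggle_badness V W a q : a \in ags -> q \in a.2 -> q \in V -> q \notin W ->
  (forall y, y != q -> (y \in V) = (y \in W)) ->
  badness k ags V <= (badness k ags W).+1 /\ badness k ags W <= (badness k ags V).+1.
Proof.
move=> ain qa qV qW h; have [l [d [_ lV lW dV dW]]] := toggle ain qa qV qW h.
by rewrite /badness lV lW dV dW; lia.
Qed.

Lemma badness_eq V W : (forall q, q \in pages ags -> (q \in V) = (q \in W)) ->
  badness k ags V = badness k ags W.
Proof.
move=> h; rewrite /badness !load_sum !lack_sum.
have e a : a \in ags -> cnt V a = cnt W a.
  by move=> ain; apply: cnt_eq => q qa; apply: h; apply: in_pages qa.
by congr (_ + (_ - _)); apply: eq_big_seq => a /e ->.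
Qed.

Lemma badness_add q V : q \in pages ags ->
  badness k ags (add q V) <= badness k ags V + (q \notin V).
Proof.
move=> /pagesP[a ain qa]; have [qV|qV] := boolP (q \in V).
  by rewrite /add qV addn0.
rewrite addn1; apply: (proj1 (toggle_badness ain qa _ qV _)).
  by rewrite in_add eqxx.
by move=> y yq; rewrite in_add (negPf yq).
Qed.

Lemma badness_del q V : q \in pages ags ->
  badness k ags (del q V) <= badness k ags V + (q \in V).
Proof.
move=> /pagesP[a ain qa]; have [qV|qV] := boolP (q \in V); last first.
  rewrite addn0 eq_leq //; apply: badness_eq => y _; rewrite in_del.
  by case: eqP => // ->; rewrite (negPf qV).
rewrite addn1; apply: (proj2 (toggle_badness ain qa qV _ _)).
  by rewrite in_del eqxx.
by move=> y yq; rewrite in_del yq.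
Qed.

(** In the first case [Y] lacks one page less at no extra load, while [X] does not fall below the
    reserve. In the second case the overload of [X] drops, again without creating a lack, and [Y]
    has room for one more page. *)
Lemma move_improves X Y a q : a \in ags -> q \in a.2 -> q \in X -> q \notin Y ->
  (cnt Y a < a.1 < cnt X a) ||
  [&& k < load ags X, load ags Y < k, a.1 < cnt X a & cnt Y a < cnt X a] ->
  badness k ags (del q X) + badness k ags (add q Y) <
  badness k ags X + badness k ags Y.
Proof.
move=> ain qa qX qY.
have [||l [d [cX lX lX' dX dX']]] := toggle (W := del q X) ain qa qX.
- by rewrite in_del eqxx.
- by move=> y yq; rewrite in_del yq.
have [||l2 [d2 [cY lY lY' dY dY']]] := toggle (V := add q Y) ain qa _ qY.
- by rewrite in_add eqxx.
- by move=> y yq; rewrite in_add (negPf yq).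
by rewrite /badness lX lX' dX dX' lY lY' dY dY' cX; lia.
Qed.

End Agents.

(** * Ensembles *)

Definition keyed N (Vs : seq (nat * seq nat)) := map fst Vs = iota 0 N.

Section Keyed.
Variable N : nat.
Implicit Types Vs Ws : seq (nat * seq nat).

Lemma keyed_size Vs : keyed N Vs -> size Vs = N.
Proof. by move=> kV; rewrite -(size_map fst) kV size_iota. Qed.

Lemma keyed_map Vs f : keyed N Vs -> keyed N [seq (c.1, f c) | c <- Vs].
Proof. by move=> kV; rewrite /keyed -map_comp. Qed.

Lemma lookup_in Vs c : keyed N Vs -> c \in Vs -> lookup c.1 Vs = c.2 /\ c.1 < N.
Proof.
move=> kV cin; split; last first.
  by have := map_f fst cin; rewrite kV mem_iota.
have : uniq (map fst Vs) by rewrite kV iota_uniq.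
rewrite /lookup; elim: Vs {kV} cin => //= d Vs IH; rewrite inE.
case/orP => [/eqP->|cin]; first by rewrite eqxx.
case/andP => dn u; case: eqP => [e|_]; last exact: IH.
by move: dn; rewrite e map_f.
Qed.

Lemma keyedE Vs : keyed N Vs -> Vs = [seq (i, lookup i Vs) | i <- iota 0 N].
Proof.
move=> kV; rewrite -[in RHS]kV -map_comp -[LHS]map_id; apply/eq_in_map => c cin.
by rewrite /= (lookup_in kV cin).1 -surjective_pairing.
Qed.

Lemma in_keyed Vs i : keyed N Vs -> i < N -> (i, lookup i Vs) \in Vs.
Proof.
move=> kV iN; rewrite {2}(keyedE kV).
by apply: (map_f (fun i => (i, lookup i Vs))); rewrite mem_iota.
Qed.

Lemma sum_keyed Vs (F : nat * seq nat -> nat) : keyed N Vs ->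
  \sum_(c <- Vs) F c = \sum_(i < N) F (val i, lookup i Vs).
Proof.
move=> kV; rewrite {1}(keyedE kV) big_map.
by rewrite -(big_mkord predT (fun i => F (i, lookup i Vs))) /index_iota subn0.
Qed.

Lemma lookup_map Vs f i : keyed N Vs -> i < N ->
  lookup i [seq (c.1, f c) | c <- Vs] = f (i, lookup i Vs).
Proof.
move=> kV iN; have kW := keyed_map f kV.
have /(map_f (fun c => (c.1, f c))) := in_keyed kV iN.
by move=> /(lookup_in kW) [].
Qed.

Lemma missing_sum Vs q : keyed N Vs ->
  missing q Vs = \sum_(i < N) (q \notin lookup i Vs).
Proof.
move=> kV; rewrite /missing size_filter -sum1_count big_mkcond /=.
rewrite (sum_keyed (fun c => if q \notin c.2 then 1 else 0) kV).
by apply: eq_bigr => i _ /=; case: (q \in _).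
Qed.

Lemma missing_le Vs q : keyed N Vs -> missing q Vs <= N.
Proof. by move=> kV; rewrite -(keyed_size kV) /missing size_filter count_size. Qed.

Lemma missing_eq0 Vs q : keyed N Vs ->
  (missing q Vs == 0) = [forall i : 'I_N, q \in lookup i Vs].
Proof.
move=> kV; rewrite missing_sum // sum_nat_eq0; apply: eq_forallb => i /=.
by rewrite eqb0 negbK.
Qed.

Lemma eq_missing Vs Ws q : keyed N Vs -> keyed N Ws ->
  (forall i, i < N -> (q \in lookup i Vs) = (q \in lookup i Ws)) ->
  missing q Vs = missing q Ws.
Proof.
by move=> kV kW h; rewrite !missing_sum //; apply: eq_bigr => i _; rewrite h.
Qed.

Lemma total_badness_sum k ags Vs : keyed N Vs ->
  total_badness k ags Vs = \sum_(i < N) badness k ags (lookup i Vs).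
Proof.
by move=> kV; rewrite /total_badness sumnE big_map
  (sum_keyed (fun c => badness k ags c.2) kV).
Qed.

Definition fetch (P : seq nat) i Vs Ws :=
  \sum_(q <- P) ((q \in lookup i Ws) && (q \notin lookup i Vs)).

Definition fetches P Vs Ws := \sum_(i < N) fetch P i Vs Ws.

Lemma fetch_trans P i Vs Ws Xs :
  fetch P i Vs Xs <= fetch P i Vs Ws + fetch P i Ws Xs.
Proof.
rewrite -big_split /=; apply: leq_sum => q _.
by case: (q \in lookup i Vs); case: (q \in lookup i Ws); case: (q \in _).
Qed.

Lemma fetches_trans P Vs Ws Xs :
  fetches P Vs Xs <= fetches P Vs Ws + fetches P Ws Xs.
Proof.
by rewrite -big_split /=; apply: leq_sum => i _; apply: fetch_trans.
Qed.

Lemma fetches0 P Vs Ws :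
  (forall i q, i < N -> q \in lookup i Ws -> q \in lookup i Vs) ->
  fetches P Vs Ws = 0.
Proof.
move=> h; rewrite /fetches big1 // => i _; rewrite /fetch big1 // => q _.
by case e: (q \in lookup i Ws) => //; rewrite h.
Qed.

Section Move.
Variables (k : nat) (ags : seq (nat * seq nat)) (Vs : seq (nat * seq nat)).
Hypotheses (uniq_pages : uniq (pages ags)) (kV : keyed N Vs).
Variables (q i j : nat).
Hypotheses (iN : i < N) (jN : j < N) (qi : q \in lookup i Vs)
  (qj : q \notin lookup j Vs).

Let ij : i != j. Proof. by apply: contraTneq qi => ->. Qed.

Lemma lookup_move l : l < N -> lookup l (move q i j Vs) =
  if l == i then del q (lookup l Vs) else
  if l == j then add q (lookup l Vs) else lookup l Vs.
Proof. by move=> lN; rewrite (lookup_map _ kV lN). Qed.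

Lemma sum2 (F : 'I_N -> nat) :
  \sum_(l < N) F l = F (Ordinal iN) + F (Ordinal jN) +
    \sum_(l < N | (l != Ordinal iN) && (l != Ordinal jN)) F l.
Proof.
rewrite (bigD1 (Ordinal iN)) //= -addnA; congr (_ + _).
rewrite (bigD1 (Ordinal jN)) //=; first by rewrite -val_eqE /= eq_sym.
Qed.

(** Hence moves change neither the deficit nor the number of missing copies: the potential sees only
    the drop in badness. *)
Lemma missing_move y : missing y (move q i j Vs) = missing y Vs.
Proof.
have kM : keyed N (move q i j Vs) by apply: keyed_map.
have [->|yq] := eqVneq y q; last first.
  apply: eq_missing => // l lN; rewrite lookup_move //.
  by do 2?[case: ifP => _]; rewrite ?in_del ?in_add ?yq ?(negPf yq).
rewrite !missing_sum // !sum2 !lookup_move //= !eqxx [j == i]eq_sym (negPf ij).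
rewrite in_del in_add eqxx /= qi qj; congr (_ + _).
apply: eq_bigr => l; rewrite -!val_eqE /= => /andP[li lj].
by rewrite lookup_move // (negPf li) (negPf lj).
Qed.

Lemma total_badness_move :
  badness k ags (del q (lookup i Vs)) + badness k ags (add q (lookup j Vs)) <
  badness k ags (lookup i Vs) + badness k ags (lookup j Vs) ->
  total_badness k ags (move q i j Vs) < total_badness k ags Vs.
Proof.
have kM : keyed N (move q i j Vs) by apply: keyed_map.
rewrite !total_badness_sum // !sum2 !lookup_move //= !eqxx [j == i]eq_sym (negPf ij).
move=> h; rewrite -addSn leq_add // eq_leq //.
apply: eq_bigr => l; rewrite -!val_eqE /= => /andP[li lj].
by rewrite lookup_move // (negPf li) (negPf lj).
Qed.

(** Only the cache [j] gains a page, and the strict decrease of the total badness will pay for this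
    one fetch. *)
Lemma fetches_move : fetches (pages ags) Vs (move q i j Vs) <= 1.
Proof.
rewrite /fetches sum2 /= [X in X + _ + _]big1; last first.
  move=> y _; rewrite lookup_move // eqxx in_del.
  by case: (y \in _); rewrite ?andbF.
rewrite add0n [X in _ + X]big1 ?addn0; last first.
  move=> l; rewrite -!val_eqE /= => /andP[li lj].
  rewrite /fetch big1 // => y _.
  by rewrite lookup_move // (negPf li) (negPf lj) andbN.
rewrite /fetch (eq_bigr (fun y => nat_of_bool (y == q))); last first.
  move=> y _; rewrite lookup_move // [j == i]eq_sym (negPf ij) eqxx in_add.
  by case: eqP => [->|_] /=; rewrite ?qj ?andbN.
rewrite (eq_bigr (fun y => if y == q then 1 else 0)).
  by rewrite -big_mkcond sum1_count count_uniq_mem // leq_b1.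
by move=> y _; case: eqP.
Qed.
End Move.
End Keyed.

(** * Thinning *)

Section Thin.
Variables (N k : nat) (ags : seq (nat * seq nat)).
Hypothesis uniq_pages : uniq (pages ags).
Implicit Types Vs Ws : seq (nat * seq nat).

Definition sub_caches Ws Vs :=
  forall i q, i < N -> q \in lookup i Ws -> q \in lookup i Vs.

(** The last clause says that the badness grows by at most the number of evicted copies, written
    without truncated subtraction. *)
Definition thinned q Vs Ws := [/\ keyed N Ws, sub_caches Ws Vs,
  forall i y, i < N -> y != q -> (y \in lookup i Ws) = (y \in lookup i Vs)
  & total_badness k ags Ws + missing q Vs <= total_badness k ags Vs + missing q Ws].

Lemma thinned_refl q Vs : keyed N Vs -> thinned q Vs Vs.
Proof. by move=> kV; split. Qed.

Lemma thinned_trans q Vs Ws Xs :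
  thinned q Vs Ws -> thinned q Ws Xs -> thinned q Vs Xs.
Proof.
move=> [_ s1 e1 b1] [kX s2 e2 b2]; split=> //.
- by move=> i y iN /(s2 _ _ iN) /(s1 _ _ iN).
- by move=> i y iN yq; rewrite e2 // e1.
- by lia.
Qed.

Lemma missing_expel q Vs : q \in pages ags -> keyed N Vs ->
  thinned q Vs (expel q Vs) /\
  missing q (expel q Vs) = minn (missing q Vs).+1 N.
Proof.
move=> qP kV; have kW : keyed N (expel q Vs) by apply: keyed_map.
have lk l : l < N -> lookup l (expel q Vs) =
    if l == (head (0, [::]) [seq c <- Vs | q \in c.2]).1
    then del q (lookup l Vs) else lookup l Vs.
  by move=> lN; rewrite (lookup_map _ kV lN).
have sub : sub_caches (expel q Vs) Vs.
  by move=> i y iN; rewrite lk //; case: ifP => _ //; rewrite in_del => /andP[].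
have other i y : i < N -> y != q ->
    (y \in lookup i (expel q Vs)) = (y \in lookup i Vs).
  by move=> iN yq; rewrite lk //; case: ifP => _ //; rewrite in_del yq.
have mle := missing_le q kV.
(* If no cache contains [q], nothing is deleted and the count already equals the cap [N]. *)
case e : [seq c <- Vs | q \in c.2] => [|c s].
  have same i y : i < N -> (y \in lookup i (expel q Vs)) = (y \in lookup i Vs).
    move=> iN; have [->|/other-> //] := eqVneq y q.
    apply/idP/idP => [|qi]; first exact: sub.
    have : (i, lookup i Vs) \in [seq c <- Vs | q \in c.2].
      by rewrite mem_filter qi (in_keyed kV).
    by rewrite e.
  have em : missing q (expel q Vs) = missing q Vs.
    by apply: (eq_missing kW kV) => i iN; rewrite same.
  have mN : missing q Vs = N.
    rewrite (missing_sum _ kV) (eq_bigr (fun=> 1)); first by rewrite sum1_card card_ord.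
    move=> i _; case qi: (q \in _) => //.
    have : (val i, lookup i Vs) \in [seq c <- Vs | q \in c.2].
      by rewrite mem_filter qi (in_keyed kV (ltn_ord i)).
    by rewrite e.
  rewrite em; split; last by rewrite mN; lia.
  split=> //; rewrite em leq_add2r eq_leq //.
  rewrite (total_badness_sum _ _ kW) (total_badness_sum _ _ kV).
  by apply: eq_bigr => i _; apply: badness_eq => y _; rewrite same.
have : c \in [seq c <- Vs | q \in c.2] by rewrite e inE eqxx.
rewrite mem_filter => /andP[qc cin]; have [lc cN] := lookup_in kV cin.
have lk' l : l < N -> lookup l (expel q Vs) =
    if l == c.1 then del q (lookup l Vs) else lookup l Vs.
  by move=> lN; rewrite lk // e.
have em : missing q (expel q Vs) = (missing q Vs).+1.
  rewrite (missing_sum _ kW) (missing_sum _ kV) (bigD1 (Ordinal cN)) //=.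
  rewrite [in RHS](bigD1 (Ordinal cN)) //= lk' //= eqxx in_del eqxx lc qc /= add0n add1n; congr _.+1.
  by apply: eq_bigr => i; rewrite -val_eqE /= => ic; rewrite lk' // (negPf ic).
have := missing_le q kW; rewrite em => ltN; split; last by lia.
split=> //; rewrite em addnS -addSn leq_add2r.
rewrite (total_badness_sum _ _ kW) (total_badness_sum _ _ kV).
rewrite (bigD1 (Ordinal cN)) //= [in X in _ <= X](bigD1 (Ordinal cN)) //=.
rewrite -addSn leq_add //.
  rewrite lk' //= eqxx lc; apply: leq_trans (badness_del k uniq_pages _ qP) _.
  by rewrite qc addn1.
rewrite eq_leq //.
by apply: eq_bigr => i; rewrite -val_eqE /= => ic; rewrite lk' // (negPf ic).
Qed.

Lemma missing_thin q Vs : q \in pages ags -> keyed N Vs ->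
  thinned q Vs (thin q Vs) /\
  missing q (thin q Vs) = minn (missing q Vs + maxn 1 (missing q Vs)) N.
Proof.
move=> qP kV; rewrite /thin; elim: (maxn _ _) => [|n [IH1 IH2]].
  by rewrite addn0; split; [exact: thinned_refl | have := missing_le q kV; rewrite /=; lia].
have [_ _ _ _] := IH1; have kW : keyed N (iter n (expel q) Vs) by case: IH1.
have [h1 h2] := missing_expel qP kW.
by rewrite iterS h2 IH2; split; [exact: thinned_trans IH1 h1 | lia].
Qed.

Definition next_missing m := minn (m + maxn 1 m) N.

Lemma missing_thin_all U Vs : uniq U -> {subset U <= pages ags} -> keyed N Vs ->
  [/\ keyed N (thin_all U Vs), sub_caches (thin_all U Vs) Vs,
    forall q, missing q (thin_all U Vs) =
      if q \in U then next_missing (missing q Vs) else missing q Vs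
    , forall i y, i < N -> y \notin U ->
        (y \in lookup i (thin_all U Vs)) = (y \in lookup i Vs)
    & total_badness k ags (thin_all U Vs) <= total_badness k ags Vs +
      \sum_(q <- U) (next_missing (missing q Vs) - missing q Vs)].
Proof.
elim: U Vs => [|q U IH] Vs /=.
  by move=> _ _ kV; split=> //; rewrite big_nil addn0.
case/andP => qU uU UP kV.
have [[kW s1 e1 b1] m1] := missing_thin (UP q (mem_head _ _)) kV.
have [|k2 s2 m2 e2 b2] := IH _ uU _ kW.
  by move=> y yU; apply: UP; rewrite inE yU orbT.
have m3 y : y != q -> missing y (thin q Vs) = missing y Vs.
  by move=> yq; apply: (eq_missing kW kV) => i iN; apply: e1.
split=> //.
- by move=> i y iN /(s2 _ _ iN) /(s1 _ _ iN).
- move=> y; rewrite m2 inE; have [->|yq] := eqVneq y q.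
    by rewrite (negPf qU) m1.
  by rewrite m3.
- by move=> i y iN; rewrite inE negb_or => /andP[yq yU]; rewrite e2 // e1.
- rewrite big_cons.
  have -> : \sum_(y <- U) (next_missing (missing y Vs) - missing y Vs) =
    \sum_(y <- U) (next_missing (missing y (thin q Vs)) - missing y (thin q Vs)).
    by apply: eq_big_seq => y yU; rewrite m3 //; apply: contraNneq qU => <-.
  apply: leq_trans b2 _; rewrite addnA leq_add2r.
  by move: b1; rewrite m1 -/(next_missing _); lia.
Qed.

End Thin.

(** * Levels of missing pages *)

Definition level a := if a == 0 then 0 else (trunc_log 2 a).+1.

(** Doubling raises the level by exactly one even when the cap intervenes: then [m] exceeds half of
    [2 ^ E], so its level is [E], while the cap has level [E.+1]. *)
Lemma level_next E m : m < 2 ^ E ->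
  level m <= E /\ level (next_missing (2 ^ E) m) = (level m).+1.
Proof.
rewrite /level /next_missing; case: m => [|m] lt /=.
  by rewrite add0n (minn_idPl _) //= trunc_log1.
set a := m.+1 in lt *.
have a0 : 0 < a by [].
have e1 : maxn 1 a = a by apply/maxn_idPr.
rewrite e1.
have tE : trunc_log 2 a < E.
  by rewrite -(ltn_exp2l _ _ (ltnSn 1)); apply: leq_ltn_trans lt; exact: trunc_logP.
have [le|gt] := leqP (a + a) (2 ^ E).
  by split=> //; rewrite addnn trunc_log2_double.
rewrite expn_eq0 /= trunc_expnK //.
split=> //; congr _.+1; apply/eqP; rewrite eqn_leq tE andbT.
rewrite -ltnS -(ltn_exp2l _ _ (ltnSn 1)) expnS.
apply: leq_trans gt _; rewrite addnn -mul2n leq_mul2l /=.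
by apply/ltnW; rewrite trunc_log_ltn.
Qed.

(** * The potential function *)

Section Potential.
Variables (E k : nat) (ags : seq (nat * seq nat)).
Hypothesis uniq_pages : uniq (pages ags).
Hypothesis lt_kN : k < 2 ^ E.
Let N := 2 ^ E.
Let P := pages ags.
Implicit Types Vs Ws : seq (nat * seq nat).

Definition feasible_seq (O : seq nat) :=
  \sum_(a <- ags) cnt O a = k /\ forall a, a \in ags -> a.1 <= cnt O a.

Definition deficit (O : seq nat) Vs :=
  \sum_(q <- P) (if q \in O then 0 else E.+1 - level (missing q Vs)).

(* Thinning lowers the deficit by some y and evicts at most 3 N y copies, each of
   which adds at most 3 to the other two terms; 10 makes the decrease strict. *)
Definition potential O Vs :=
  10 * N * deficit O Vs + total_badness k ags Vs + 2 * \sum_(q <- P) missing q Vs.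

Lemma N_gt0 : 0 < N. Proof. by rewrite expn_gt0. Qed.

Lemma sum_missing_cnt Vs a : keyed N Vs ->
  \sum_(i < N) cnt (lookup i Vs) a + \sum_(q <- a.2) missing q Vs = N * size a.2.
Proof.
move=> kV; rewrite (eq_bigr (fun i : 'I_N => \sum_(q <- a.2) (q \in lookup i Vs))).
  rewrite exchange_big -big_split /= (eq_bigr (fun=> N)).
    by rewrite big_const_seq count_predT iter_addn_0.
  move=> q _; rewrite (missing_sum _ kV) -big_split /=.
  rewrite (eq_bigr (fun=> 1)) ?sum1_card ?card_ord // => i _.
  by case: (q \in _).
by move=> i _; rewrite cnt_sum.
Qed.

Lemma cold_or_hot Vs a : keyed N Vs ->
  let h := has (fun c : nat * seq nat => a.1 < cnt c.2 a) Vs in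
  if h then exists2 i, i < N & a.1 < cnt (lookup i Vs) a
  else forall i, i < N -> cnt (lookup i Vs) a <= a.1.
Proof.
move=> kV /=; case: hasP => [[c cin ac]|h].
  by have [lc cN] := lookup_in kV cin; exists c.1; rewrite ?lc.
move=> i iN; rewrite leqNgt; apply/negP => lt.
by apply: h; exists (i, lookup i Vs); first exact: (in_keyed kV).
Qed.

Definition balanced Vs := forall a i j, a \in ags -> i < N -> j < N ->
  ~~ (cnt (lookup j Vs) a < a.1 < cnt (lookup i Vs) a).

Lemma sum_hot p Vs (F : nat -> nat) :
  \sum_(q <- hot ags p Vs) F q = \sum_(a <- ags)
    \sum_(q <- a.2 | (q != p) && has (fun c : nat * seq nat => a.1 < cnt c.2 a) Vs) F q.
Proof.
by rewrite /hot big_flatten big_map; apply: eq_bigr => a _; rewrite big_filter.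
Qed.


(** The total load is compared with [N * k], that is, with [N] copies of [O], agent by agent. A cold
    agent loads every cache with exactly its reserve, which [O] holds as well. A hot agent is
    nowhere below its reserve, by balance, so its load is its number of copies: [N] for each of its
    pages less the missing ones. Since the total exceeds [N * k], the hot pages outside [O], taken
    [N] times, must outweigh the missing copies of hot pages. *)
Lemma hot_missing O p Vs : keyed N Vs -> feasible_seq O -> p \in O ->
  missing p Vs = 0 -> balanced Vs -> overloaded k ags Vs ->
  \sum_(q <- hot ags p Vs) missing q Vs < N * \sum_(q <- hot ags p Vs) (q \notin O).
Proof.
move=> kV [kO fO] pO mp bal; rewrite /overloaded (keyed_size kV) sumnE big_map.
rewrite (sum_keyed (fun c => load ags c.2) kV) /=.
rewrite (eq_bigr (fun i : 'I_N => \sum_(a <- ags) maxn (cnt (lookup i Vs) a) a.1));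
  last by move=> i _; rewrite load_sum.
rewrite exchange_big /= !sum_hot => over.
rewrite -(ltn_add2l (N * k)).
move: over; rewrite -(ltn_add2r (\sum_(a <- ags) \sum_(q <- a.2 |
  (q != p) && has (fun c : nat * seq nat => a.1 < cnt c.2 a) Vs) missing q Vs)).
move=> /leq_trans; apply.
rewrite -kO !big_distrr -!big_split /= !big_seq; apply: leq_sum => a ain.
have := cold_or_hot a kV => /=.
case: (has _ _) => [[i iN ai]|cold]; last first.
  have none (F : nat -> nat) : \sum_(q <- a.2 | (q != p) && false) F q = 0.
    by rewrite big_pred0 // => q; rewrite andbF.
  rewrite !none muln0 !addn0; apply: leq_trans (_ : N * a.1 <= _); last by rewrite leq_mul ?fO.
  have -> : N * a.1 = \sum_(l < N) a.1 by rewrite sum_nat_const card_ord.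
  by apply: leq_sum => l _; rewrite geq_max cold /=.
have hi l : l < N -> a.1 <= cnt (lookup l Vs) a.
  by move=> lN; have := bal a i l ain iN lN; rewrite ai andbT -leqNgt.
rewrite (eq_bigr (fun l : 'I_N => cnt (lookup l Vs) a)); last first.
  by move=> l _; apply/maxn_idPl; exact: hi.
(* The exclusion of [p] from the hot pages does not affect the count: [p] is missing nowhere and
   lies in [O], so it contributes 0 to both sums. *)
have drop (F : nat -> nat) : F p = 0 ->
    \sum_(q <- a.2 | (q != p) && true) F q = \sum_(q <- a.2) F q.
  move=> Fp; rewrite big_mkcond /=; apply: eq_bigr => q _.
  by rewrite andbT; case: eqP => // ->.
rewrite !drop ?mp ?pO // sum_missing_cnt // -mulnDr leq_mul2l cnt_sum -big_split /=.
rewrite (eq_bigr (fun=> 1)) ?sum1_size ?leqnn ?orbT // => q _.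
by case: (q \in O).
Qed.

Lemma subseq_flatten_filter (f : nat * seq nat -> pred nat) (s : seq (nat * seq nat)) :
  subseq (flatten [seq filter (f a) a.2 | a <- s]) (pages s).
Proof.
by elim: s => //= a s IH; rewrite /pages /=; apply: cat_subseq; [exact: filter_subseq|].
Qed.

Lemma hot_subseq p Vs : subseq (hot ags p Vs) P.
Proof. exact: (subseq_flatten_filter (fun a q => (q != p) && has _ Vs)). Qed.

Lemma notin_hot p Vs : p \notin hot ags p Vs.
Proof.
apply/negP => /flattenP[s /mapP[a _ ->]].
by rewrite mem_filter eqxx.
Qed.

Lemma sum_sub U (F : nat -> nat) : subseq U P ->
  \sum_(q <- P) (if q \in U then F q else 0) = \sum_(q <- U) F q.
Proof.
move=> sUP; rewrite -big_mkcond -big_filter; apply: perm_big; apply: uniq_perm.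
- exact: filter_uniq.
- exact: subseq_uniq uniq_pages.
move=> q; rewrite mem_filter; case qU : (q \in U) => //=.
by rewrite (mem_subseq sUP).
Qed.

(** The caches hold at most [N * k.+1] copies altogether: at most [k] pages in each calm cache, plus
    the requested page. *)
Definition spread Vs := N * size P <= N * k.+1 + \sum_(q <- P) missing q Vs.

(** Here [y] counts the hot pages outside [O] that some cache still holds. A doubled page still held
    somewhere gains at most [m + 1] missing copies, so the evictions [ev] are at most [A + B], where
    [A] sums [m] over these pages and [B] counts them. From [A < N * y], [B <= N + y] and [y > 0]
    follows [ev <= 3 * (N * y)]. *)
Lemma thin_hot O p Vs : keyed N Vs -> feasible_seq O -> p \in O ->
  missing p Vs = 0 -> balanced Vs -> overloaded k ags Vs -> spread Vs ->
  let Ws := thin_all (hot ags p Vs) Vs in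
  [/\ keyed N Ws, sub_caches N Ws Vs, missing p Ws = 0, spread Ws
    & potential O Ws < potential O Vs].
Proof.
move=> kV fO pO mp bal over spr; set U := hot ags p Vs => Ws.
have sUP : subseq U P by exact: hot_subseq.
have uU : uniq U by apply: subseq_uniq sUP _.
have [kW sub mW _ tbW] := missing_thin_all k uniq_pages uU (mem_subseq sUP) kV.
have key := hot_missing kV fO pO mp bal over; rewrite -/U in key.
pose m q := missing q Vs.
pose t q := (q \notin O) && (m q < N).
set ev := \sum_(q <- U) _ in tbW.
have spr' : N * size P <= N * k.+1 + \sum_(q <- P) m q := spr.
have mle q : m q <= N by apply: missing_le.
have next_ge q : m q <= next_missing N (m q) by rewrite /next_missing; have := mle q; lia.
have mWs q : missing q Ws = m q + (if q \in U then next_missing N (m q) - m q else 0).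
  by rewrite mW; case: (q \in U); rewrite ?addn0 // subnKC // next_ge.
have sumW : \sum_(q <- P) missing q Ws = \sum_(q <- P) m q + ev.
  by rewrite (eq_bigr _ (fun q _ => mWs q)) big_split /= sum_sub.
(* Each page counted by [t] rises exactly one level, from a level at most [E], so the truncated
   subtraction drops by exactly 1. A page missing everywhere keeps its level. *)
have defW : deficit O Ws + \sum_(q <- U) t q = deficit O Vs.
  rewrite -(sum_sub _ sUP) -big_split /=; apply: eq_bigr => q _.
  rewrite mW /t -/(m q); case: (q \in O) => /=; first by case: (q \in U).
  case: (q \in U); rewrite ?addn0 //.
  have [lt|ge] := ltnP (m q) N.
    by have [l1 l2] := level_next lt; rewrite l2; lia.
  have -> : m q = N by apply/eqP; rewrite eqn_leq mle.
  by rewrite addn0 /next_missing; congr (_ - level _); lia.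
set y := \sum_(q <- U) t q in defW.
pose A := \sum_(q <- U) (if m q < N then m q else 0).
pose B := \sum_(q <- U) (m q < N).
pose F := \sum_(q <- U) (if m q < N then 0 else N).
have eA : \sum_(q <- U) missing q Vs = A + F.
  rewrite -big_split /=; apply: eq_bigr => q _; rewrite -/(m q).
  by case: ltnP => h; rewrite ?addn0 //; apply/eqP; rewrite eqn_leq mle.
have eY : N * \sum_(q <- U) (q \notin O) <= N * y + F.
  rewrite !big_distrr -big_split /=; apply: leq_sum => q _; rewrite /t.
  by case: ltnP => h; case: (q \in O); rewrite /= ?muln1 ?muln0 ?addn0.
(* Pages missing from all caches contribute [F] to the left side of [key] and at most [F] to the
   right side. *)
have lA : A < N * y by rewrite -(ltn_add2r F) -eA; apply: leq_trans eY.
have y0 : 0 < y by case: (y) lA => //; rewrite muln0.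
(* A page counted by [B] has [N - m] copies present and [m] missing. All copies present number at
   most [N * k.+1], by [spread], and [k.+1 <= N]; the missing ones sum to [A < N * y]. *)
have lB : B <= N + y.
  have : N * B <= N * k.+1 + A.
    apply: (@leq_trans (\sum_(q <- U) (N - m q) + A)).
      rewrite big_distrr -big_split /=; apply: leq_sum => q _.
      by case: ltnP => h; rewrite ?muln1 ?muln0 // subnK // ltnW.
    rewrite leq_add2r; apply: (@leq_trans (\sum_(q <- P) (N - m q))).
      by rewrite -(sum_sub _ sUP); apply: leq_sum => q _; case: (q \in U).
    have : \sum_(q <- P) (N - m q) + \sum_(q <- P) m q = N * size P.
      rewrite -big_split /= (eq_bigr (fun=> N)) => [|q _]; last by rewrite subnK.
      by rewrite big_const_seq count_predT iter_addn_0.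
    by move: spr'; lia.
  move=> h; rewrite -(leq_pmul2l N_gt0) mulnDr.
  apply: leq_trans h _; apply: leq_add; last exact: ltnW.
  by rewrite leq_mul2l lt_kN orbT.
have lev : ev <= A + B.
  rewrite -big_split /=; apply: leq_sum => q _; rewrite -/(m q) /next_missing.
  by case: ltnP => h; have := mle q; lia.
split=> //.
- by rewrite mW (negPf (notin_hot p Vs)).
- by rewrite /spread sumW; move: spr'; lia.
rewrite /potential sumW -defW.
have ev3 : ev <= 3 * (N * y).
  move: (leq_pmulr N y0) (leq_pmull y N_gt0) lev lA lB.
  move: (N * y) => z h1 h2 h3 h4 h5.
  by clearbody N A B y ev; clear - h1 h2 h3 h4 h5; lia.
have N1 := leq_mul N_gt0 y0; rewrite muln1 in N1.
have -> : \sum_(q <- P) missing q Vs = \sum_(q <- P) m q by [].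
rewrite !mulnDr -!mulnA; rewrite -/Ws in tbW; move: tbW ev3 N1.
by move: (N * y) (N * deficit O Ws) => a b; clear; lia.
Qed.

End Potential.

(** * Serving a request *)

Section Serve.
Variables (E k : nat) (ags : seq (nat * seq nat)).
Hypothesis uniq_pages : uniq (pages ags).
Hypothesis lt_kN : k < 2 ^ E.
Let N := 2 ^ E.
Let P := pages ags.
Implicit Types Vs Ws : seq (nat * seq nat).

Definition calm Vs := forall i, i < N -> load ags (lookup i Vs) <= k.

Lemma cnt_lt_exists X Y a : cnt Y a < cnt X a ->
  exists q, [/\ q \in a.2, q \in X & q \notin Y].
Proof.
move=> lt; have : has (fun q => (q \in X) && (q \notin Y)) a.2.
  apply: contraTT lt => /hasPn h; rewrite -leqNgt; apply: cnt_le => q qa qX.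
  by have := h q qa; rewrite qX negbK.
by case/hasP => q qa /andP[qX qY]; exists q.
Qed.

Lemma better_nonempty Vs a i j : keyed N Vs -> a \in ags -> i < N -> j < N ->
  let X := lookup i Vs in let Y := lookup j Vs in
  (cnt Y a < a.1 < cnt X a) ||
  [&& k < load ags X, load ags Y < k, a.1 < cnt X a & cnt Y a < cnt X a] ->
  better k ags Vs <> [::].
Proof.
move=> kV ain iN jN X Y cond.
have /cnt_lt_exists[q [qa qX qY]] : cnt Y a < cnt X a by lia.
have imp := total_badness_move kV iN jN qX qY
  (move_improves uniq_pages ain qa qX qY cond).
suff : move q i j Vs \in better k ags Vs by move=> + e; rewrite e.
rewrite mem_filter imp /=; apply/flattenP.
exists (flatten [seq [seq move q c.1 d.1 Vs | d <- Vs & q \notin d.2]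
                       | c <- Vs & q \in c.2]).
  by apply: map_f; apply: in_pages qa.
apply/flattenP; exists [seq move q i d.1 Vs | d <- Vs & q \notin d.2].
  apply/mapP; exists (i, X) => //.
  by rewrite mem_filter qX (in_keyed kV).
apply/mapP; exists (j, Y) => //.
by rewrite mem_filter qY (in_keyed kV).
Qed.

Lemma no_better_balanced Vs : keyed N Vs -> better k ags Vs = [::] ->
  balanced E ags Vs.
Proof.
move=> kV nb a i j ain iN jN; apply/negP => h.
by apply: (better_nonempty kV ain iN jN) nb => /=; rewrite h.
Qed.

(** If one cache is loaded above [k] while the average is not, another is loaded below [k]. Some
    agent contributes more to the load of the first than to that of the second; it is then above its
    reserve in the first and has a page whose move would be an improvement. *)
Lemma no_better_calm Vs : keyed N Vs -> better k ags Vs = [::] ->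
  ~~ overloaded k ags Vs -> calm Vs.
Proof.
move=> kV nb; rewrite /overloaded (keyed_size kV) sumnE big_map.
rewrite (sum_keyed (fun c => load ags c.2) kV) /= -leqNgt => le i iN.
rewrite leqNgt; apply/negP => ki.
have [j jN kj] : exists2 j, j < N & load ags (lookup j Vs) < k.
  have : [exists j : 'I_N, load ags (lookup j Vs) < k].
    apply: contraTT le; rewrite negb_exists => /forallP h; rewrite -ltnNge.
    have -> : N * k = \sum_(l < N) k by rewrite sum_nat_const card_ord.
    rewrite (bigD1 (Ordinal iN)) //= [in X in _ < X](bigD1 (Ordinal iN)) //=.
    rewrite -addSn leq_add //; apply: leq_sum => l _.
    by have := h l; rewrite -leqNgt.
  by case/existsP => j kj; exists j.
have : has (fun a => maxn (cnt (lookup j Vs) a) a.1 <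
                     maxn (cnt (lookup i Vs) a) a.1) ags.
  have : load ags (lookup j Vs) < load ags (lookup i Vs) by lia.
  apply: contraTT => /hasPn h; rewrite -leqNgt !load_sum !big_seq.
  by apply: leq_sum => a /h; rewrite -leqNgt.
case/hasP => a ain lt.
by apply: (better_nonempty kV ain iN jN) nb => /=; rewrite ki kj; lia.
Qed.

Definition ready p Vs := [/\ keyed N Vs, missing p Vs = 0 & spread E k ags Vs].

Notation pot := (potential E k ags).

Lemma round_step O p Vs : feasible_seq k ags O -> p \in O -> ready p Vs ->
  let Ws := round k ags p Vs in
  (Ws = Vs /\ calm Vs) \/
  [/\ ready p Ws, fetches N P Vs Ws + pot O Ws <= pot O Vs
    & pot O Ws < pot O Vs].
Proof.
move=> fO pO [kV mp spr] Ws; case: (roundP k ags p Vs); rewrite -/Ws.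
- rewrite mem_filter => /andP[tb /movesP[q [c [d [eW qP [cin qc] [din qd]]]]]].
  right.
  have [lc cN] := lookup_in kV cin; have [ld dN] := lookup_in kV din.
  rewrite -lc in qc; rewrite -ld in qd.
  have mW y : missing y Ws = missing y Vs.
    by rewrite eW (missing_move kV cN dN).
  have f1 : fetches N P Vs Ws <= 1.
    by rewrite eW (fetches_move uniq_pages kV cN dN).
  have sW : \sum_(y <- P) missing y Ws = \sum_(y <- P) missing y Vs.
    by apply: eq_bigr => y _; rewrite mW.
  have dW : deficit E ags O Ws = deficit E ags O Vs.
    by apply: eq_bigr => y _; rewrite mW.
  have lt : pot O Ws < pot O Vs.
    by rewrite /potential dW sW ltn_add2r ltn_add2l.
  split=> //; last by lia.
  split; [by rewrite eW; apply: keyed_map|by rewrite mW|].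
  by rewrite /spread sW.
- case=> nb over eW; right.
  have [kW sub mW sprW lt] := thin_hot uniq_pages lt_kN kV fO pO mp
    (no_better_balanced kV nb) over spr.
  rewrite eW; split=> //; rewrite fetches0 ?add0n; first exact: ltnW.
  exact: sub.
- by case=> nb over eW; left; split=> //; apply: no_better_calm.
Qed.

(** A round either is a fixed point, and remains one, or lowers the potential by at least 1. This
    holds for every feasible [O] containing [p], although the rounds do not depend on [O]. *)
Lemma iter_round O p n Vs : feasible_seq k ags O -> p \in O -> ready p Vs ->
  let Ws := iter n (round k ags p) Vs in
  [/\ ready p Ws, fetches N P Vs Ws + pot O Ws <= pot O Vs
    & round k ags p Ws = Ws /\ calm Ws \/ pot O Ws + n <= pot O Vs].
Proof.
move=> fO pO rV; elim: n => [|n [IH1 IH2 IH3]] /=.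
  split=> //; first by rewrite fetches0.
  by right; rewrite addn0.
have [[e c]|[r f lt]] := round_step fO pO IH1.
  by rewrite !e; split=> //; left.
split=> //.
  have := fetches_trans N P Vs (iter n (round k ags p) Vs)
    (round k ags p (iter n (round k ags p) Vs)); lia.
case: IH3 => [[e c]|h]; last by right; lia.
by rewrite e ltnn in lt.
Qed.

Lemma load_le V O : feasible_seq k ags O -> load ags V <= size P + k.
Proof.
move=> [kO fO]; rewrite load_sum -kO -sum1_size sum_pages -big_split /= !big_seq.
apply: leq_sum => a ain; rewrite geq_max (leq_trans (fO _ ain)) ?leq_addl // andbT.
apply: leq_trans (leq_addr _ _); rewrite cnt_sum; apply: leq_sum => q _.
by case: (q \in V).
Qed.

(** As [E.+1 <= N], the three terms are at most [10 * N * N * size P], [N * (k + size P)] and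
    [2 * N * size P]; with [k < N], the factor 20 leaves ample room. *)
Lemma potential_bound O Vs : feasible_seq k ags O -> keyed N Vs ->
  pot O Vs < 20 * N * N * (size P).+1.
Proof.
move=> fO kV; have N0 : 0 < N := N_gt0 E.
have EN : E.+1 <= N by exact: ltn_expl.
have d : deficit E ags O Vs <= size P * N.
  rewrite -sum1_size big_distrl /=; apply: leq_sum => q _; rewrite mul1n.
  by case: ifP => // _; apply: leq_trans (leq_subr _ _) EN.
have b V : badness k ags V <= k + size P.
  have := load_le V fO; rewrite /badness.
  have : lack ags V <= k.
    rewrite lack_sum -(proj1 fO) !big_seq; apply: leq_sum => a ain.
    by apply: leq_trans (leq_subr _ _) _; apply: (proj2 fO).
  by lia.
have tb : total_badness k ags Vs <= N * (k + size P).
  rewrite (total_badness_sum _ _ kV).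
  have -> : N * (k + size P) = \sum_(i < N) (k + size P).
    by rewrite sum_nat_const card_ord.
  by apply: leq_sum => i _.
have m : \sum_(q <- P) missing q Vs <= size P * N.
  rewrite -sum1_size big_distrl /=; apply: leq_sum => q _; rewrite mul1n.
  exact: missing_le.
have d2 : N * deficit E ags O Vs <= N * (size P * N) by rewrite leq_mul2l d orbT.
have k2 : N * k < N * N by rewrite ltn_pmul2l.
have p2 : N * size P <= N * (N * size P) by rewrite leq_mul2l leq_pmull // orbT.
rewrite /potential mulnS -!mulnA.
move: d2 k2 p2 tb m; rewrite mulnDr [size P * N]mulnC.
move: (N * (N * size P)) (N * deficit _ _ _ _) (N * N) (N * size P) (N * k).
by move: (total_badness _ _ _) (\sum_(q <- P) _) => *; lia.
Qed.

(** Inserting [p] costs one fetch and at most one unit of badness in each cache that lacked it, and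
    removes one missing copy there: the weight 2 of the missing copies pays for both. The deficit
    does not change, since [p] lies in [O]. The rounds pay for themselves. *)
Lemma serve_step O p Vs : feasible_seq k ags O -> p \in O -> p \in P ->
  keyed N Vs -> calm Vs ->
  let Ws := serve k ags p Vs in
  [/\ keyed N Ws, calm Ws, missing p Ws = 0
    & fetches N P Vs Ws + pot O Ws <= pot O Vs].
Proof.
move=> fO pO pP kV cV; set Is := insert p Vs.
have kI : keyed N Is by apply: (keyed_map (fun c => add p c.2)).
have lI i : i < N -> lookup i Is = add p (lookup i Vs).
  by move=> iN; rewrite (lookup_map (fun c => add p c.2) kV iN).
have mIp : missing p Is = 0.
  by rewrite (missing_sum _ kI) big1 // => i _; rewrite lI // in_add eqxx.
have mI q : q != p -> missing q Is = missing q Vs.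
  move=> qp; apply: (eq_missing kI kV) => i iN.
  by rewrite lI // in_add (negPf qp).
have sI : \sum_(q <- P) missing q Is + missing p Vs = \sum_(q <- P) missing q Vs.
  rewrite !(bigD1_seq p) //= mIp add0n addnC; congr (_ + _).
  by apply: eq_bigr => q; exact: mI.
have dI : deficit E ags O Is = deficit E ags O Vs.
  apply: eq_bigr => q _; have [->|/mI-> //] := eqVneq q p.
  by rewrite pO.
have tI : total_badness k ags Is <= total_badness k ags Vs + missing p Vs.
  rewrite (total_badness_sum _ _ kV) (total_badness_sum _ _ kI) (missing_sum _ kV).
  rewrite -big_split /=; apply: leq_sum => i _; rewrite lI //.
  exact: badness_add.
have fI : fetches N P Vs Is <= missing p Vs.
  rewrite (missing_sum _ kV); apply: leq_sum => i _; rewrite /fetch.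
  rewrite (bigD1_seq p) //= big1 ?addn0 => [|q qp]; first by case: (_ \in _).
  by rewrite lI // in_add (negPf qp) andbN.
have potI : fetches N P Vs Is + pot O Is <= pot O Vs.
  by rewrite /potential dI -/P -sI; move: fI tI; clear; lia.
have spr : spread E k ags Is.
  have : N * size P <= N * k + \sum_(q <- P) missing q Vs.
    have -> : N * size P = \sum_(a <- ags) N * size a.2.
      rewrite -big_distrr /=; congr (_ * _).
      by rewrite -sum1_size sum_pages; apply: eq_bigr => a _; rewrite sum1_size.
    rewrite sum_pages (eq_bigr _ (fun a _ => esym (sum_missing_cnt a kV))).
    rewrite big_split /= leq_add2r exchange_big /=.
    have -> : N * k = \sum_(i < N) k by rewrite sum_nat_const card_ord.
    apply: leq_sum => i _; apply: leq_trans (cV i _) => //; rewrite load_sum.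
    by apply: leq_sum => a _; rewrite leq_maxl.
  rewrite /spread -sI -/N -/P; have := missing_le p kV; lia.
have rI : ready p Is by [].
have [[kW mW _] f [[_ c]|h]] :=
  iter_round (20 * size Vs * size Vs * (size P).+1) fO pO rI.
  split=> //; rewrite /serve -/P -/Is.
  have := fetches_trans N P Vs Is
    (iter (20 * size Vs * size Vs * (size P).+1) (round k ags p) Is); move: f potI; clear; lia.
(* Otherwise the potential would have dropped by the full number of rounds, which exceeds its
   initial value. *)
by have := potential_bound fO kI; rewrite (keyed_size kV) in h *; lia.
Qed.

Lemma deficit_move O O' Vs : deficit E ags O' Vs <=
  deficit E ags O Vs + E.+1 * \sum_(q <- P) ((q \in O) && (q \notin O')).
Proof.
rewrite big_distrr -big_split /=; apply: leq_sum => q _.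
by case: (q \in O); case: (q \in O'); rewrite /= ?muln0 ?muln1 ?addn0 ?leq_subr.
Qed.

(** Only the deficit depends on [O], and a page that leaves [O] adds at most [E.+1] to it. *)
Lemma potential_move O O' Vs : pot O' Vs <= pot O Vs +
  10 * N * E.+1 * \sum_(q <- P) ((q \in O) && (q \notin O')).
Proof.
rewrite /potential -!mulnA -/N.
have : N * deficit E ags O' Vs <= N * (deficit E ags O Vs +
    E.+1 * \sum_(q <- P) ((q \in O) && (q \notin O'))).
  by rewrite leq_mul2l deficit_move orbT.
by rewrite mulnDr; clear; lia.
Qed.

End Serve.

(** * Completing a virtual cache *)

Section Refit.
Variables (k : nat) (ags : seq (nat * seq nat)).
Hypothesis uniq_pages : uniq (pages ags).
Variables V C : seq nat.
Hypotheses (calmV : load ags V <= k) (fC : feasible_seq k ags C).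

Let weight X := \sum_(a <- ags) cnt X a.

Definition admissible X := [/\ k <= weight X,
  forall a, a \in ags -> a.1 <= cnt X a, {subset V <= X}
  & {subset X <= V ++ C}].

(* Slots that no longer offer a page to evict; stable as X shrinks. *)
Definition settled X (aq : nat * seq nat * nat) :=
  [|| weight X <= k, aq.2 \notin X, aq.2 \in V | cnt X aq.1 <= aq.1.1].

Lemma weight_mono X Y : {subset X <= Y} -> weight X <= weight Y.
Proof. by move=> s; apply: leq_sum => a _; apply: cnt_le => q _ /s. Qed.

Lemma settled_mono X Y aq : {subset X <= Y} -> settled Y aq -> settled X aq.
Proof.
move=> s; have wXY := weight_mono s; rewrite /settled => /or4P[h|h|->|h].
- by rewrite (leq_trans wXY h).
- by rewrite (contraNN (s _) h) orbT.
- by rewrite !orbT.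
- have : cnt X aq.1 <= cnt Y aq.1 by apply: cnt_le => q _ /s.
  by move=> h2; rewrite (leq_trans h2 h) !orbT.
Qed.

Lemma evict_step X a q : a \in ags -> q \in a.2 -> admissible X ->
  let Y := evict k ags V X (a, q) in
  [/\ admissible Y, {subset Y <= X} & settled Y (a, q)].
Proof.
move=> ain qa [wX rX VX XC]; rewrite /evict /= sumnE big_map -/(weight X).
case: ifP => [/and3P[qV kw ra]|cond]; last first.
  split=> //; apply/negPn/negP; rewrite /settled /= !negb_or -!ltnNge negbK.
  by move=> /and4P[h1 h2 h3 h4]; rewrite h1 h3 h4 in cond.
have sub : {subset del q X <= X} by move=> y; rewrite in_del => /andP[].
split=> //; last by rewrite /settled /= in_del eqxx orbT.
have [qX|qX] := boolP (q \in X); last first.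
  have e a' : cnt (del q X) a' = cnt X a'.
    by apply: cnt_eq => y _; rewrite in_del; case: eqP => // ->; rewrite (negPf qX).
  split.
  - by rewrite /weight (eq_bigr _ (fun a' _ => e a')).
  - by move=> a' /rX; rewrite e.
  - by move=> y yV; rewrite in_del VX // andbT; apply: contraNneq qV => <-.
  - by move=> y /sub /XC.
have [rest pr nq] := agent_split uniq_pages ain qa.
have cX : cnt X a = (cnt (del q X) a).+1.
  apply: (cnt_toggle (q := q)) => //; first exact: (agent_uniq uniq_pages).
    by rewrite in_del eqxx.
  by move=> y yq; rewrite in_del yq.
have cr b : b \in rest -> cnt (del q X) b = cnt X b.
  move=> bin; apply: cnt_eq => y yb; rewrite in_del.
  by case: eqP => // e; move: (nq b bin); rewrite -e yb.
split.
- move: kw; rewrite /weight !(perm_big _ pr) /= !big_cons cX addSn ltnS.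
  by rewrite (eq_big_seq _ cr).
- move=> b bin; have [->|ba] := eqVneq b a; first by rewrite -ltnS -cX.
  have : b \in a :: rest by rewrite -(perm_mem pr).
  by rewrite inE (negPf ba) => /cr ->; apply: rX.
- by move=> y yV; rewrite in_del VX // andbT; apply: contraNneq qV => <-.
- by move=> y /sub /XC.
Qed.

Lemma evict_all s X : (forall aq, aq \in s -> aq.1 \in ags /\ aq.2 \in aq.1.2) ->
  admissible X ->
  let Y := foldl (evict k ags V) X s in
  [/\ admissible Y, {subset Y <= X} & forall aq, aq \in s -> settled Y aq].
Proof.
elim: s X => [|[a q] s IH] X /= ins aX; first by split.
have [ain qa] := ins _ (mem_head _ _).
have [aY sY dY] := evict_step ain qa aX.
have [|aZ sZ dZ] := IH _ _ aY; first by move=> aq h; apply: ins; rewrite inE h orbT.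
split=> // [y /sZ /sY //|aq]; rewrite inE => /orP[/eqP->|/dZ //].
exact: settled_mono dY.
Qed.

(** Greedy eviction ends with exactly [k] pages. If more were left, every agent with a page of [X]
    outside [V] would be down to its reserve, and every other agent would hold no more than in [V];
    the weight would then be at most [load ags V <= k]. *)
Lemma refit_spec : let X := foldl (evict k ags V) (V ++ C) (slots ags) in
  [/\ feasible_seq k ags X, {subset V <= X} & {subset X <= V ++ C}].
Proof.
move=> X; have [kC rC] := fC.
have inslots aq : aq \in slots ags -> aq.1 \in ags /\ aq.2 \in aq.1.2.
  by case/flattenP => s /mapP[a ain ->] /mapP[q qa ->].
have cle a : cnt C a <= cnt (V ++ C) a.
  by apply: cnt_le => q _ qC; rewrite mem_cat qC orbT.
have a0 : admissible (V ++ C).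
  split=> //.
  - by rewrite -kC; apply: leq_sum.
  - by move=> a /rC h; apply: leq_trans h _.
  - by move=> y yV; rewrite mem_cat yV.
have [[wX rX VX XC] _ dX] := evict_all inslots a0.
rewrite -/X in wX rX VX XC dX; split=> //; split=> //.
apply/eqP; rewrite -/(weight X) eqn_leq wX andbT leqNgt; apply/negP => kw.
suff : weight X <= load ags V by move: kw calmV; rewrite /weight; lia.
rewrite load_sum /weight !big_seq; apply: leq_sum => a ain.
have [/hasP[q qa /andP[qX qV]]|/hasPn h] :=
    boolP (has (fun q => (q \in X) && (q \notin V)) a.2); last first.
  apply: leq_trans (leq_maxl _ _); apply: cnt_le => q qa qX.
  by have := h q qa; rewrite qX negbK.
have /dX : (a, q) \in slots ags.
  apply/flattenP; exists [seq (a, q) | q <- a.2]; last exact: map_f.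
  exact: (map_f (fun a => [seq (a, q) | q <- a.2])).
rewrite /settled /= leqNgt kw qX (negPf qV) /= => h.
exact: leq_trans h (leq_maxr _ _).
Qed.

End Refit.

(** * Runs on a system *)

Section System.
Variable S : system.
Let k := cache_size S.
Let n := num_pages S.
Implicit Types (C O : cache S) (p : page S).

Definition vals (C : cache S) : seq nat := [seq val q | q <- enum C].

Definition agent_of (i : 'I_(num_agents S)) := (reserve i, vals (pages_of i)).

Definition agents := [seq agent_of i | i <- enum 'I_(num_agents S)].

Lemma mem_vals C p : (val p \in vals C) = (p \in C).
Proof. by rewrite mem_map ?mem_enum //; exact: val_inj. Qed.

Lemma enc_systemE : enc_system S = enc (k, agents).
Proof.
rewrite /enc_system /agents /= /enc_pair /= -!map_comp.
congr (Node _ (enc_seq _)); apply: eq_map => i.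
by rewrite /= /enc_pair /= /enc_set /enc_pages /vals -map_comp.
Qed.

Lemma enc_setE C : enc_set C = enc (vals C).
Proof. by rewrite /enc_set /enc_pages /= /vals -map_comp. Qed.

Lemma pages_agents : pages agents = [seq val q | q <- flatten
  [seq enum (pages_of i) | i <- enum 'I_(num_agents S)]].
Proof. by rewrite /pages /agents map_flatten -!map_comp. Qed.

Lemma uniq_agents : uniq (pages agents).
Proof.
rewrite pages_agents map_inj_uniq; last exact: val_inj.
elim: (enum _) (enum_uniq 'I_(num_agents S)) => //= i s IH /andP[nis us].
rewrite cat_uniq enum_uniq IH // andbT; apply/hasPn => q /flattenP[t /mapP[j js ->]].
rewrite !mem_enum => qj; apply/negP => qi.
have ij : i != j by apply: contraNneq nis => ->.
by move: (pages_disjoint ij) => /pred0P/(_ q) /=; rewrite qi qj.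
Qed.

Lemma perm_pages : perm_eq (pages agents) (iota 0 n).
Proof.
apply: uniq_perm; [exact: uniq_agents|exact: iota_uniq|] => q.
rewrite mem_iota add0n /=; apply/idP/idP => [|qn].
  by rewrite pages_agents => /mapP[p _ ->]; exact: (ltn_ord p).
have : Ordinal qn \in \bigcup_i pages_of i by rewrite pages_cover inE.
case/bigcupP => i _ qi; rewrite pages_agents; apply/mapP; exists (Ordinal qn) => //.
apply/flattenP; exists (enum (pages_of i)); last by rewrite mem_enum.
by apply: (map_f (fun i => enum (pages_of i))); rewrite mem_enum.
Qed.

Lemma size_pages : size (pages agents) = n.
Proof. by rewrite (perm_size perm_pages) size_iota. Qed.

Lemma in_agents p : val p \in pages agents.
Proof. by rewrite (perm_mem perm_pages) mem_iota /=. Qed.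

Lemma sum_pages_ord (F : nat -> nat) :
  \sum_(q <- pages agents) F q = \sum_(p : page S) F (val p).
Proof.
by rewrite (perm_big _ perm_pages) /= -{1}[n]subn0 -/(index_iota 0 n) big_mkord.
Qed.

Definition cache_of (X : seq nat) : cache S := [set p | val p \in X].

Lemma cnt_agent X i : cnt X (agent_of i) = #|cache_of X :&: pages_of i|.
Proof.
rewrite cnt_sum big_map big_enum /= -sum1_card big_mkcond /=.
rewrite [RHS]big_mkcond /=; apply: eq_bigr => p _; rewrite !inE.
by case: (p \in pages_of i); case: (val p \in X).
Qed.

Lemma cache_ofK C : cache_of (vals C) = C.
Proof. by apply/setP => p; rewrite inE mem_vals. Qed.

Lemma feasibleE X : feasible (cache_of X) <-> feasible_seq k agents X.
Proof.
have e : \sum_(a <- agents) cnt X a = #|cache_of X|.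
  rewrite card_cache big_map big_enum /=; apply: eq_bigr => i _.
  by rewrite cnt_agent.
rewrite /feasible /feasible_seq e; split.
  case/andP => /eqP -> /forallP r; split=> // a /mapP[i _ ->].
  by rewrite cnt_agent; apply: r.
case=> -> r; rewrite eqxx; apply/forallP => i.
by rewrite -cnt_agent; apply: (r (agent_of i)); rewrite map_f ?mem_enum.
Qed.

Lemma feasible_vals C : feasible C -> feasible_seq k agents (vals C).
Proof. by move=> f; apply/feasibleE; rewrite cache_ofK. Qed.

(** The potential is charged for pages leaving [O], whereas a schedule pays for pages entering it;
    feasible caches have equal size, so the two counts agree. *)
Lemma card_setD_feasible C C' : feasible C -> feasible C' -> #|C :\: C'| = #|C' :\: C|.
Proof.
move=> /andP[/eqP c _] /andP[/eqP c' _].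
by have := cardsID C' C; have := cardsID C C'; rewrite setIC c c'; lia.
Qed.

Lemma sum_vals_diff C C' :
  \sum_(q <- pages agents) ((q \in vals C) && (q \notin vals C')) = #|C :\: C'|.
Proof.
rewrite sum_pages_ord -sum1_card [RHS]big_mkcond /=; apply: eq_bigr => p _.
by rewrite !mem_vals inE andbC; case: (_ && _).
Qed.

Definition exponent := (trunc_log 2 k).+1.

Lemma k_gt0 : 0 < k.
Proof. exact: leq_ltn_trans (reserve_lt S). Qed.

Lemma lt_pow_exponent : k < 2 ^ exponent.
Proof. exact: trunc_log_ltn. Qed.

Lemma pow_exponent_le : 2 ^ exponent <= 2 * k.
Proof. by rewrite expnS leq_mul2l trunc_logP ?k_gt0. Qed.

Lemma refit_cache V C : load agents V <= k -> feasible C ->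
  let C' := cache_of (refit k agents V (vals C)) in
  [/\ feasible C', forall p, val p \in V -> p \in C'
    & forall p, p \in C' -> val p \in V \/ p \in C].
Proof.
move=> lV fC C'.
have [fX VX XC] := refit_spec uniq_agents lV (feasible_vals fC).
set X := foldl _ _ _ in fX VX XC.
have e : C' = cache_of X.
  apply/setP => p; rewrite [LHS]inE [RHS]inE /refit mem_filter mem_iota size_pages.
  by rewrite leq0n add0n (ltn_ord p) !andbT.
rewrite e; split; first by apply/feasibleE.
- by move=> p /VX; rewrite inE.
- move=> p; rewrite inE => /XC; rewrite mem_cat mem_vals.
  by case/orP; [left|right].
Qed.

Lemma vals_refit V D : let X := refit k agents V D in vals (cache_of X) = X.
Proof.
move=> X; rewrite /vals.
have -> : enum (cache_of X) = [seq p <- enum 'I_n | val p \in X].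
  by rewrite enumT; apply: eq_filter => p; rewrite -[mem _ p]/(p \in cache_of X) [LHS]inE.
rewrite -(filter_map val (fun q => q \in X)) val_enum_ord.
have eX : X = [seq q <- iota 0 n
    | q \in foldl (evict k agents V) (V ++ D) (slots agents)].
  by rewrite /X /refit size_pages.
rewrite [RHS]eX; apply: eq_in_filter => q qn.
by rewrite eX mem_filter qn andbT.
Qed.

End System.

(** Since [dec] is total, this is defined on every memory, reachable or not. *)
Definition alg_step (S : system) (cf : config S) (p : page S) (w : seq bool) :
    config S :=
  let y := full ((cache_size S, agents S), ((dec cf.1, vals cf.2), (val p, w))) in
  (enc y.1, cache_of S y.2).

(** Degree 1 provides one coin more than the instance size at each request. The cache size is
    encoded in unary, so the first string alone suffices to draw the index; later coins are
    ignored. *)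
Definition alg := OnlineAlg 1 alg_step.

Section Run.
Variable S : system.
Let k := cache_size S.
Let ags := agents S.
Let N := 2 ^ exponent S.
Implicit Types (C O : cache S) (p : page S).

Record good v Vs (cf : config S) : Prop := Good {
  good_mem : cf.1 = enc ((v, [::]) :: Vs : seq (nat * seq nat));
  good_keyed : keyed N Vs;
  good_calm : calm (exponent S) k ags Vs;
  good_lt : v < N;
  good_feasible : feasible cf.2;
  good_sub : forall p, val p \in lookup v Vs -> p \in cf.2 }.

(** The new real cache consists of pages of the chosen virtual cache and of the old real cache,
    which contained the old virtual cache. Every real fetch is therefore a fetch of the virtual
    cache. *)
Lemma step_good v Vs cf p w : good v Vs cf ->
  let cf' := alg_step cf p w in let Ws := serve k ags (val p) Vs in
  [/\ good v Ws cf', p \in cf'.2 & #|cf'.2 :\: cf.2| <= fetch (pages ags) v Vs Ws].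
Proof.
case=> em kV cV vN fC sub cf' Ws.
(* Any feasible cache containing [p] can stand in for the optimum here, since only the shape of [Ws]
   is wanted. *)
have [O fO pO] := feasible_swap p fC.
have [] := serve_step (uniq_agents S) (lt_pow_exponent S) (feasible_vals fO) _ (in_agents p) kV cV.
  by rewrite mem_vals.
rewrite -/Ws => kW cW mW _.
have ecf : cf' = (enc ((v, [::]) :: Ws : seq (nat * seq nat)),
    cache_of S (refit k ags (lookup v Ws) (vals cf.2))).
  by rewrite /cf' /alg_step em encK /full /boot /respond.
have [f' V' C'] := refit_cache (cW _ vN) fC.
have pW : val p \in lookup v Ws.
  have := missing_eq0 (val p) kW; rewrite mW => /esym/forallP/(_ (Ordinal vN)).
  exact.
rewrite ecf; split; last 1 first.
- rewrite /fetch (sum_pages_ord S (fun q => (q \in lookup v Ws) && (q \notin lookup v Vs))).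
  rewrite -sum1_card [X in X <= _]big_mkcond; apply: leq_sum => q _ /=.
  rewrite !in_setD; case qC : (q \in cf.2) => //=.
  case qR : (q \in _) => //; case: (C' _ qR) => [->|]; last by rewrite qC.
  by rewrite /=; case e: (val q \in lookup v Vs) => //; rewrite (sub _ e) in qC.
- by [].
- exact: V'.
Qed.

Fixpoint total_fetch v Vs (rs : seq (page S)) :=
  if rs is p :: rs' then
    let Ws := serve k ags (val p) Vs in
    fetch (pages ags) v Vs Ws + total_fetch v Ws rs'
  else 0.

Lemma run_good v rs ws : forall Vs cf, good v Vs cf -> size ws = size rs ->
  let Cs := [seq c.2 | c <- scanl (fun cf pw => alg_step cf pw.1 pw.2) cf (zip rs ws)] in
  valid_schedule rs Cs /\ schedule_cost cf.2 Cs <= total_fetch v Vs rs.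
Proof.
elim: rs ws => [|p rs IH] [|w ws] //= Vs cf gd [sz].
have [gd' pC cost] := step_good p w gd.
have [val' cost'] := IH ws _ _ gd' sz.
rewrite /valid_schedule /= pC (good_feasible gd') /=; split=> //.
by rewrite /schedule_cost /= leq_add.
Qed.

Definition initial (C0 : cache S) : seq (nat * seq nat) :=
  [seq (i, vals C0) | i <- iota 0 N].

Lemma initial_good v C0 : feasible C0 -> v < N ->
  good v (initial C0) (enc ((v, [::]) :: initial C0 : seq (nat * seq nat)), C0).
Proof.
move=> fC vN.
have kI : keyed N (initial C0) by rewrite /keyed -map_comp map_id.
have lI i : i < N -> lookup i (initial C0) = vals C0.
  move=> iN; have : (i, vals C0) \in initial C0.
    by apply: (map_f (fun i => (i, vals C0))); rewrite mem_iota.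
  by move=> /(lookup_in kI) [].
split=> //.
  move=> i iN; rewrite lI // load_sum.
  have [kE r] := feasible_vals fC; rewrite /k -kE !big_seq; apply: leq_sum => a ain.
  by rewrite geq_max leqnn r.
by move=> p; rewrite lI // mem_vals.
Qed.

(** The potential telescopes. At each request the optimal cache moves first, which raises the
    potential by at most [10 * N * (exponent S).+1] per page; its new cache contains [p], and
    relative to it the drop of the potential pays for the virtual fetches. *)
Lemma total_fetch_le rs : forall Vs O (Os : seq (cache S)),
  keyed N Vs -> calm (exponent S) k ags Vs -> feasible O -> valid_schedule rs Os ->
  \sum_(v < N) total_fetch v Vs rs <=
    potential (exponent S) k ags (vals O) Vs + 10 * N * (exponent S).+1 * schedule_cost O Os.
Proof.
elim: rs => [|p rs IH] Vs O [|O' Os] //= kV cV fO; first by rewrite big1.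
case/andP => /andP[fO' pO'] vOs.
have [|kW cW _ pot] := serve_step (uniq_agents S) (lt_pow_exponent S) (feasible_vals fO') _
  (in_agents p) kV cV; first by rewrite mem_vals.
have ih := IH _ _ _ kW cW fO' vOs.
have mv := potential_move (exponent S) k ags (vals O) (vals O') Vs.
rewrite sum_vals_diff (card_setD_feasible fO fO') in mv.
rewrite big_split /= /schedule_cost /= mulnDr.
move: ih pot mv; rewrite /schedule_cost /fetches -/N -/k -/ags /=; clear; lia.
Qed.

End Run.

(** * Random choice of the virtual cache *)

Section Draw.
Variables (k e0 : nat).
Hypotheses (le_k : 2 ^ e0 <= k) (lt_k : k < 2 ^ e0.+1).

Lemma draw_stable v M w : k < M -> foldl (draw_step k) (v, M) w = (v, M).
Proof. by move=> kM; elim: w => //= b w; rewrite /draw_step /= leqNgt kM. Qed.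

Lemma draw_step_pow v j b : j <= e0 -> v < 2 ^ j ->
  draw_step k (v, 2 ^ j) b = (v + v + b, 2 ^ j.+1) /\ v + v + b < 2 ^ j.+1.
Proof.
move=> je vj; have jk : 2 ^ j <= k by apply: leq_trans le_k; rewrite leq_exp2l.
rewrite /draw_step /= jk (leq_trans (ltnW vj) jk) expnS mul2n -addnn.
by split; [case: b | case: b; lia].
Qed.

Lemma draw_spec w : forall e v j, j + e = e0.+1 -> v < 2 ^ j -> e <= size w ->
  let vM := foldl (draw_step k) (v, 2 ^ j) w in
  vM.2 = 2 ^ e0.+1 /\ vM.1 < 2 ^ e0.+1.
Proof.
elim: w => [|b w IH] [|e] v j //=; rewrite ?addn0 => je vj ew.
- by rewrite -je.
- by rewrite /draw_step /= je [_ <= k]leqNgt lt_k draw_stable // -je.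
- have [|-> lt] := @draw_step_pow v j b _ vj; first by lia.
  by apply: (IH e) => //; rewrite addSnnS.
Qed.

Lemma draw_take n w : e0 < n -> n <= size w -> draw k (take n w) = draw k w.
Proof.
move=> en nw; rewrite -[in RHS](cat_take_drop n w) /draw foldl_cat.
have := @draw_spec (take n w) e0.+1 0 0 erefl isT; rewrite size_takel // expn0.
by move=> /(_ en); case: (foldl _ _ _) => v M [/= -> _]; rewrite draw_stable.
Qed.

Lemma sum_tupleS L (F : seq bool -> nat) : \sum_(W : L.+1.-tuple bool) F W =
  \sum_(W : L.-tuple bool) F (false :: W) + \sum_(W : L.-tuple bool) F (true :: W).
Proof.
rewrite (reindex (fun bW : bool * L.-tuple bool => [tuple of bW.1 :: bW.2])) /=.
  rewrite -(pair_big xpredT xpredT (fun (b : bool) (W : L.-tuple bool) => F (b :: W))) /=.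
  by rewrite big_bool addnC.
exists (fun W : L.+1.-tuple bool => (thead W, [tuple of behead W])).
  by move=> [b W] _ /=; congr (_, _); apply/val_inj.
by move=> W _; rewrite /= [RHS]tuple_eta; apply/val_inj.
Qed.

(** The next [e] coins are the remaining binary digits of the index and the other coins are ignored,
    so each of the [2 ^ e] continuations of [v] comes from [2 ^ (L - e)] tapes. For [v = 0] and
    [j = 0] this is the uniformity of the drawn index. *)
Lemma sum_draw (f : nat -> nat) e : forall L v j,
  j + e = e0.+1 -> v < 2 ^ j -> e <= L ->
  \sum_(W : L.-tuple bool) f (foldl (draw_step k) (v, 2 ^ j) W).1 =
  2 ^ (L - e) * \sum_(0 <= u < 2 ^ e) f (v * 2 ^ e + u).
Proof.
elim: e => [|e IH] L v j je vj eL.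
  rewrite subn0 expn0 big_nat1 muln1 addn0.
  rewrite (eq_bigr (fun=> f v)); first by rewrite sum_nat_const card_tuple card_bool.
  by move=> W _; rewrite draw_stable // -[j]addn0 je.
case: L eL => // L eL; rewrite (sum_tupleS L (fun w => f (foldl _ _ w).1)) /=.
have [|e1 l1] := @draw_step_pow v j false _ vj; first by lia.
have [|e2 l2] := @draw_step_pow v j true _ vj; first by lia.
rewrite e1 e2 !(IH L) ?addSnnS // subSS -mulnDr; congr (_ * _).
rewrite expnS mul2n -addnn (big_cat_nat (leq0n (2 ^ e)) (leq_addr (2 ^ e) (2 ^ e))) /=.
congr (_ + _).
  by apply: eq_bigr => u _; congr f; lia.
have shift (g : nat -> nat) : \sum_(2 ^ e <= u < 2 ^ e + 2 ^ e) g u =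
    \sum_(0 <= u < 2 ^ e) g (u + 2 ^ e).
  by rewrite -{1}[2 ^ e]add0n big_addn addnK.
rewrite shift; by apply: eq_bigr => u _; congr f; lia.
Qed.

End Draw.

Section Cost.
Variable S : system.
Let k := cache_size S.
Let N := 2 ^ exponent S.
Implicit Types (C O : cache S) (p : page S).

Lemma exponent_le_coins C0 rs : exponent S <= num_coins alg C0 rs.
Proof.
have Ek : exponent S <= k.
  by apply: leq_trans (ltn_expl _ _) (trunc_logP _ (k_gt0 S)).
rewrite /num_coins /poly_bound mul1n expn1; apply: leq_trans Ek _.
have : data_size (enc_nat k) = k.*2.+1 := esize_nat k.
rewrite /instance_size /= -/k; lia.
Qed.

(** The empty memory acts as the initial ensemble with the drawn index, so the analysis can start
    from a good configuration. *)
Lemma first_step C0 p w : exponent S <= size w ->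
  alg_step (init_config C0) p w =
  alg_step (enc (((draw k w).1, [::]) :: initial C0 : seq (nat * seq nat)), C0) p w.
Proof.
move=> Ew; have := @draw_spec k _ (trunc_logP (ltnSn 1) (k_gt0 S)) (lt_pow_exponent S)
  w (exponent S) 0 0 erefl isT Ew.
rewrite expn0 -/(draw k w) => -[d2 d1].
have -> : alg_step (enc (((draw k w).1, [::]) :: initial C0 : seq (nat * seq nat)), C0) p w =
  let y := respond k (agents S) (val p) (vals C0) (((draw k w).1, [::]) :: initial C0) in
  (enc y.1, cache_of S y.2) by rewrite /alg_step encK.
by rewrite /alg_step /full /boot /= d2.
Qed.

Lemma draw_lt w : exponent S <= size w -> (draw k w).1 < N.
Proof.
move=> Ew; have := @draw_spec k _ (trunc_logP (ltnSn 1) (k_gt0 S)) (lt_pow_exponent S)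
  w (exponent S) 0 0 erefl isT Ew.
by case.
Qed.

Lemma run_alg C0 p rs w ws : feasible C0 -> exponent S <= size w -> size ws = size rs ->
  valid_schedule (p :: rs) (run_caches alg C0 (p :: rs) (w :: ws)) /\
  run_cost alg C0 (p :: rs) (w :: ws) <=
    total_fetch (draw k w).1 (initial C0) (p :: rs).
Proof.
move=> fC Ew sz.
have gd := initial_good fC (draw_lt Ew).
have [] := run_good (rs := p :: rs) (ws := w :: ws) gd; first by rewrite /= sz.
pose f := fun (cf : config S) (pw : page S * seq bool) => alg_step cf pw.1 pw.2.
have scanE x : scanl f x (zip (p :: rs) (w :: ws)) =
  f x (p, w) :: scanl f (f x (p, w)) (zip rs ws) by [].
rewrite /run_cost /run_caches /run -/f !scanE.
have -> : f (init_config C0) (p, w) = f (enc (((draw k w).1, [::]) :: initial C0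
    : seq (nat * seq nat)), C0) (p, w) by exact: first_step.
by [].
Qed.

Lemma alg_integral C0 rs ws : feasible C0 -> shape ws = coin_shape alg C0 rs ->
  valid_schedule rs (run_caches alg C0 rs ws).
Proof.
case: rs ws => [|p rs] [|w ws] //= fC [sw sws].
apply: (proj1 (run_alg _ fC _ _)); first by rewrite sw exponent_le_coins.
by rewrite -(size_map size) -/(shape ws) sws size_map size_iota.
Qed.

Lemma sum_run_cost C0 p rs sh : feasible C0 -> sh = coin_shape alg C0 (p :: rs) ->
  \sum_(W : (sumn sh).-tuple bool) run_cost alg C0 (p :: rs) (reshape sh W) <=
  2 ^ (sumn sh - exponent S) * \sum_(v < N) total_fetch v (initial C0) (p :: rs).
Proof.
move=> fC shE.
have := sum_draw (trunc_logP (ltnSn 1) (k_gt0 S)) (lt_pow_exponent S)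
  (fun v => total_fetch v (initial C0) (p :: rs)) (e := exponent S) (L := sumn sh)
  (v := 0) (j := 0) erefl isT.
have [n [sh' [esh En ssh]]] : exists n sh',
    [/\ sh = n :: sh', exponent S <= n & size sh' = size rs].
  exists (num_coins alg C0 (take 1 (p :: rs))), (behead sh).
  by rewrite shE; split; [|exact: exponent_le_coins|rewrite /= size_map size_iota].
rewrite expn0 esh /= (leq_trans En (leq_addr _ _)) => /(_ isT).
rewrite big_mkord => <-; apply: leq_sum => W _.
have szW := size_tuple W.
(* [sum_draw] reads the whole tape, the algorithm only its first string; that string is long enough
   to give the same index. *)
rewrite -/(draw k W) -(draw_take (trunc_logP (ltnSn 1) (k_gt0 S)) (lt_pow_exponent S) En).
  apply: (proj2 (run_alg _ fC _ _)).
    by rewrite size_takel // szW leq_addr.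
  rewrite -ssh -(size_map size) -/(shape _) reshapeKl //.
  by rewrite size_drop szW addKn.
by rewrite szW leq_addr.
Qed.

End Cost.

(** * Memory size *)

Lemma draw_bound k w : (draw k w).1 <= 2 * k + 1 /\ (draw k w).2 <= 2 * k + 1.
Proof.
suff h v M : v <= 2 * k + 1 -> M <= 2 * k + 1 ->
    let vM := foldl (draw_step k) (v, M) w in vM.1 <= 2 * k + 1 /\ vM.2 <= 2 * k + 1.
  by apply: h; lia.
elim: w v M => //= b w IH v M vk Mk; rewrite /draw_step /=.
by case: ifP => [/andP[h1 h2]|_]; apply: IH => //; case: b; lia.
Qed.

Lemma esize_seq_le (s : seq nat) M : (forall q, q \in s -> q <= M) ->
  esize s <= size s * (2 * M + 2) + 1.
Proof.
elim: s => // q s IH h; rewrite esize_cons esize_nat /=.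
have IHs : esize s <= size s * (2 * M + 2) + 1.
  by apply: IH => y ys; apply: h; rewrite inE ys orbT.
by have := h q (mem_head _ _); rewrite mulSn -addnn; lia.
Qed.

Lemma esize_serve k ags p Vs M L :
  size Vs <= M -> size (pages ags) <= L -> esize ags <= L -> p <= L ->
  size (serve k ags p Vs) = size Vs /\
  esize (serve k ags p Vs) <=
    esize Vs + (M * (2 * L + 2) + 20 * M * M * L.+1 * (M * L.+1)).
Proof.
move=> VM PL aL pL.
have sI : size (insert p Vs) = size Vs by rewrite size_map.
have eI : esize (insert p Vs) <= esize Vs + M * (2 * L + 2).
  apply: leq_trans (esize_map_snd (m := 2 * L + 2) _ _) _.
    move=> c; apply: leq_trans (esize_add _ _) _; rewrite leq_add2l esize_nat.
    by rewrite -addnn; lia.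
  by rewrite leq_add2l leq_mul2r VM orbT.
have h f : size (iter f (round k ags p) (insert p Vs)) = size Vs /\
    esize (iter f (round k ags p) (insert p Vs)) <=
      esize Vs + M * (2 * L + 2) + f * (M * L.+1).
  elim: f => [|f [IH1 IH2]]; first by rewrite sI /= mul0n addn0.
  have [r1 r2] := esize_round k ags p (iter f (round k ags p) (insert p Vs)).
  rewrite iterS r1; split=> //; apply: leq_trans r2 _.
  rewrite IH1 mulSn addnCA [X in _ <= X]addnC leq_add //.
  by rewrite leq_mul.
have [h1 h2] := h (20 * size Vs * size Vs * (size (pages ags)).+1).
split=> //; apply: leq_trans h2 _; rewrite addnA leq_add2l leq_mul2r.
by apply/orP; right; rewrite !leq_mul.
Qed.

Section Memory.
Variables (S : system) (L : nat).
Let k := cache_size S.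
Let ags := agents S.
Hypothesis sizeL : data_size (enc_system S) <= L.

Lemma esize_system : k <= L /\ esize ags <= L.
Proof.
move: sizeL; rewrite enc_systemE -/(esize _) esize_pair esize_nat -addnn.
by rewrite -/k -/ags; lia.
Qed.

Lemma size_pages_le : size (pages ags) <= L.
Proof.
apply: leq_trans (proj2 esize_system).
elim: ags => //= a s IH; rewrite /pages /= size_cat esize_cons.
rewrite [X in (esize X + _).+1]surjective_pairing esize_pair.
rewrite -/(pages s); have := @size_le_esize _ nat_encodable a.2; lia.
Qed.

Lemma esize_vals (C : cache S) : esize (vals C) <= L * (2 * L + 2) + 1.
Proof.
have nL : num_pages S <= L by rewrite -size_pages size_pages_le.
apply: leq_trans (esize_seq_le (M := L) _) _.
  by move=> q /mapP[p _ ->]; apply: leq_trans nL; rewrite ltnW // (ltn_ord p).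
rewrite leq_add2r leq_mul2r; apply/orP; right; rewrite size_map -cardE.
by apply: leq_trans (max_card _) _; rewrite card_ord.
Qed.

(* A request enlarges the memory by at most a fixed amount, so polynomial size
   needs no invariant on the stored lists. *)
Definition memory_size t := (2 * L + 1) *
    (2 * (2 * L + 1) + 4 + (L * (2 * L + 2) + 1)) + 1 +
  t * ((2 * L + 1) * (2 * L + 2) +
       20 * (2 * L + 1) * (2 * L + 1) * L.+1 * ((2 * L + 1) * L.+1)).

Definition small_memory t (mem : seq (nat * seq nat)) :=
  nilp mem \/ exists v Vs, [/\ mem = (v, [::]) :: Vs, v <= 2 * L + 1,
    size Vs <= 2 * L + 1 & esize Vs <= memory_size t].

Lemma small_memory_boot t (C : cache S) w mem : small_memory t mem ->
  let st := boot k (vals C) w mem in small_memory t st /\ ~~ nilp st.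
Proof.
rewrite /boot; case: ifP => [_ _|nmem sm]; last by rewrite nmem.
split=> //; right.
have [d1 d2] := draw_bound k w; have [kL _] := esize_system.
exists (draw k w).1, [seq (i, vals C) | i <- iota 0 (draw k w).2].
rewrite size_map size_iota; split=> //; try by lia.
apply: (@leq_trans ((draw k w).2 *
    (2 * (2 * L + 1) + 4 + (L * (2 * L + 2) + 1)) + 1)); last first.
  rewrite /memory_size; apply: leq_trans (leq_addr _ _); rewrite leq_add2r.
  by rewrite leq_mul2r; apply/orP; right; lia.
have : all (fun i => i <= 2 * L + 1) (iota 0 (draw k w).2).
  by apply/allP => i; rewrite mem_iota; lia.
rewrite -{3}(size_iota 0 (draw k w).2); elim: (iota _ _) => //= i s IH /andP[iL sL].
rewrite esize_cons esize_pair esize_nat -addnn; have := IH sL.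
by have := esize_vals C; rewrite [(size s).+1 * _]mulSn; lia.
Qed.

Lemma small_memory_step t (cf : config S) (p : page S) w mem :
  cf.1 = enc mem -> small_memory t mem ->
  exists2 mem', (alg_step cf p w).1 = enc mem' & small_memory t.+1 mem'.
Proof.
move=> em sm.
exists (full ((k, ags), ((mem, vals cf.2), (val p, w)))).1.
  by rewrite /alg_step em encK.
have [] := small_memory_boot cf.2 w sm; rewrite /full /respond [(_, _).1]/=.
set st := boot _ _ _ _ => -[nil_st|[v [Vs [est vL sV eV]]] nnil].
  by rewrite nil_st.
rewrite est; right; exists v, (serve k ags (val p) Vs).
have pL : val p <= L.
  by apply: leq_trans size_pages_le; rewrite size_pages ltnW // (ltn_ord p).
have [s1 s2] := esize_serve k sV size_pages_le (proj2 esize_system) pL.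
split=> //; first by rewrite s1.
apply: leq_trans s2 _; move: eV; rewrite /memory_size [t.+1 * _]mulSn.
move: (_ + 20 * _ * _ * _ * _) (_ * _ + 1) => G B0.
by move: (t * G) => tG; lia.
Qed.

Lemma small_memory_run (C0 : cache S) rs ws : size ws = size rs ->
  exists2 mem, (last (init_config C0) (run alg C0 rs ws)).1 = enc mem
    & small_memory (size rs) mem.
Proof.
rewrite /run => sz.
have : exists2 mem, (init_config C0).1 = enc mem & small_memory 0 mem.
  by exists [::] => //; left.
rewrite -[size rs]add0n; move: 0 (init_config C0) => t cf.
elim: rs ws t cf sz => [|p rs IH] [|w ws] //= t cf; first by rewrite addn0.
move=> [sz] [mem em sm]; rewrite addnS -addSn; apply: IH => //.
exact: small_memory_step em sm.
Qed.

End Memory.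

(** * Running time and competitive ratio *)

Lemma alg_polytime : polytime alg.
Proof.
have [c [a [run_c _]]] := poly_full.
(* [X I] bounds the input of a step when [I] is the size of the instance revealed so far. At most
   [I] requests precede, so the memory has size at most [memory_size I I], apart from its leading
   entry. *)
pose X I := I + (memory_size I I + 2 * (2 * I + 1) + 4) +
  (I * (2 * I + 2) + 1) + (2 * I + 1) + (4 * (I + 1) + 1) + 10.
(* The summand 1 is the size of the stack, which is [Leaf] at the start. *)
have [a' boundX] : pbd (fun I => poly_bound a (X I + 1)).
  by rewrite /X /memory_size; pbd_tac.
exists c, a' => S C0 rs p ws w fC shw szw; cbv zeta; set cf := last _ _.
set I := instance_size C0 (rcons rs p).
have sysI : data_size (enc_system S) <= I by rewrite /I /instance_size /=; lia.
have rsI : size rs <= I.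
  have : data_size (enc_pages (rcons rs p)) <= I by rewrite /I /instance_size /=; lia.
  apply: leq_trans; rewrite /enc_pages map_rcons.
  by elim: (rs) => //= q s IH; lia.
have sz : size ws = size rs.
  by rewrite -(size_map size) -/(shape ws) shw size_map size_iota.
have [mem em sm] := small_memory_run sysI C0 sz.
have memI : esize mem <= memory_size I I + 2 * (2 * I + 1) + 4.
  case: sm => [/nilP ->|[v [Vs [-> vL _ VL]]]]; first by rewrite esize_nil; lia.
  rewrite esize_cons esize_pair esize_nat esize_nil -addnn.
  have : memory_size I (size rs) <= memory_size I I.
    by rewrite /memory_size leq_add2l leq_mul2r rsI orbT.
  by lia.
have pI : val p <= I.
  by apply: leq_trans (size_pages_le sysI); rewrite size_pages ltnW // (ltn_ord p).
have wI : esize w <= 4 * (I + 1) + 1.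
  have -> : I + 1 = size w by rewrite szw /num_coins /poly_bound mul1n expn1 addn1.
  elim: (w) => //= b s IH; rewrite esize_cons.
  by have := esize_bool b; lia.
pose x := ((cache_size S, agents S), ((mem, vals cf.2), (val p, w))).
have encx : enc_step_input cf p w = enc x.
  by rewrite /enc_step_input /enc_config enc_systemE enc_setE em.
have sizex : esize x <= X I.
  rewrite /x !esize_pair !esize_nat -!addnn.
  move: sysI memI wI (esize_vals sysI cf.2) pI.
  rewrite enc_systemE -/(esize _) esize_pair esize_nat -addnn /X; clear.
  move: (memory_size I I) (esize mem) (esize w) (esize (vals _)) => M m e v.
  by move: (esize (agents S)) (cache_size S) (val p) (I * _) => g k q z; lia.
have outx : enc_config (alg_step cf p w) = enc (full x).
  rewrite /enc_config enc_setE /alg_step em encK -/x /full /respond.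
  by rewrite vals_refit.
have is0 : input_store (enc x) 0 = enc x by rewrite /input_store /update eqxx.
have [t [s [ex s0 _ tt]]] := run_c x _ is0.
exists t, s; rewrite encx outx; split=> //.
apply: leq_trans tt _; apply: leq_trans (boundX I).
by apply: poly_bound_mono => //; rewrite /= leq_add2r.
Qed.

Import Order.TTheory GRing.Theory Num.Theory.
Local Open Scope ring_scope.

(** Averaging over the [N] indices divides the bound of [total_fetch_le] by [N]. The initial
    potential, at most [b], is kept undivided as the additive constant. *)
Lemma expected_cost_le (R : realType) (S : system) (C0 : cache S) rs :
  feasible C0 ->
  expected_cost alg C0 R rs <= (10 * (exponent S).+1)%:R * (opt_cost C0 rs)%:R +
    (20 * 2 ^ exponent S * 2 ^ exponent S * (num_pages S).+1)%:R.
Proof.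
move=> fC; set N := (2 ^ exponent S)%N; set b := (20 * N * N * _)%N.
case: rs => [|p rs].
  rewrite /expected_cost big1 ?mul0r; first by rewrite addr_ge0 ?mulr_ge0 ?ler0n.
  by move=> W _; rewrite /run_cost /run_caches /run.
rewrite /expected_cost; set sh := coin_shape _ _ _.
have ET : (exponent S <= sumn sh)%N.
  have -> : sumn sh = (num_coins alg C0 (take 1 (p :: rs)) + sumn (behead sh))%N by [].
  by apply: leq_trans (exponent_le_coins _ _) (leq_addr _ _).
have [[Os vO <-] _] := opt_costP (p :: rs) fC.
have gd := initial_good fC (expn_gt0 2 (exponent S) : (0 < 2 ^ exponent S)%N).
have le1 := sum_run_cost fC (erefl sh).
have le2 := total_fetch_le (good_keyed gd) (good_calm gd) fC vO.
have le3 := potential_bound (uniq_agents S) (lt_pow_exponent S) (feasible_vals fC) (good_keyed gd).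
rewrite size_pages in le3.
set cost := schedule_cost C0 Os in le2 *.
have le : (\sum_(W : (sumn sh).-tuple bool) run_cost alg C0 (p :: rs) (reshape sh W) <=
    2 ^ (sumn sh - exponent S) * (b + 10 * N * (exponent S).+1 * cost))%N.
  apply: leq_trans le1 _; rewrite leq_mul2l; apply/orP; right.
  by apply: leq_trans le2 _; rewrite leq_add2r ltnW.
rewrite -natr_sum ler_pdivrMr ?exprn_gt0 ?ltr0n //.
rewrite -natrM -natrD -natrX -natrM ler_nat; apply: leq_trans le _.
have -> : (2 ^ sumn sh)%N = (2 ^ (sumn sh - exponent S) * N)%N by rewrite -expnD subnK.
rewrite mulnCA leq_mul2l mulnDl; apply/orP; right.
rewrite addnC leq_add //; last by rewrite leq_pmulr // expn_gt0.
by rewrite eq_leq // -!mulnA; congr (10 * _)%N; rewrite mulnC mulnA.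
Qed.

(** This is the logarithm of [2 ^ (exponent S).+1 <= 4 * k <= (1 + k) ^ 2]. *)
Lemma exponent_le_ln (R : realType) (S : system) :
  (exponent S).+1%:R * ln 2 <= 2 * ln (1 + (cache_size S)%:R) :> R.
Proof.
set k := cache_size S.
have ->: (exponent S).+1%:R * ln 2 = ln (2 ^+ (exponent S).+1) :> R.
  by rewrite lnXn ?ltr0n // mulr_natl.
have -> : 2 * ln (1 + k%:R) = ln ((1 + k%:R) ^+ 2) :> R.
  by rewrite lnXn ?mulr_natl // ltr_pwDl ?ler0n.
have p1 : 0 < 1 + k%:R :> R by rewrite ltr_pwDl ?ler0n.
rewrite ler_ln ?posrE ?exprn_gt0 ?ltr0n //.
rewrite nat1r -!natrX ler_nat expnS.
by have := pow_exponent_le S; rewrite -/k; nia.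
Qed.

Theorem theorem2 (R : realType) :
  exists (C : R) (B : online_alg),
    [/\ integral_alg B,
        polytime B
      & forall S : system, exists b : R,
          forall (C0 : cache S) (rs : seq (page S)), feasible C0 ->
            expected_cost B C0 R rs
              <= C * ln (1 + (cache_size S)%:R) * (opt_cost C0 rs)%:R + b].
Proof.
(* The ratio is [10 * (exponent S).+1], and [exponent_le_ln] replaces [(exponent S).+1] by
   [2 / ln 2] times the logarithm. *)
exists (20 / ln 2), alg; split.
- by move=> S C0 rs ws; exact: alg_integral.
- exact: alg_polytime.
move=> S; exists (20 * 2 ^ exponent S * 2 ^ exponent S * (num_pages S).+1)%N%:R => C0 rs fC.
apply: le_trans (expected_cost_le R rs fC) _; rewrite lerD2r ler_wpM2r ?ler0n //.
have ln2 : 0 < ln 2 :> R by rewrite ln_gt0 // ltr1n.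
rewrite natrM mulrAC ler_pdivlMr // -mulrA (_ : 20 = 10 * 2) -?natrM // natrM -mulrA.
by rewrite ler_wpM2l ?ler0n // exponent_le_ln.
Qed.
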